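(* Let $\{a_n,b_n\}_{n=1}^\infty$ be Jacobi parameters with $$\sum_{n=1}^\infty n\bigl(|a_n-1|+|b_n|\bigr)<\infty .$$ Define $0\le\theta_1^{(n)}<\theta_2^{(n)}<\cdots$ so that $E_j^{(n)}=2\cos(\theta_j^{(n)})$, $j=1,2,\dots$, are the zeros of $p_n$ nearest to $x=2$ and below (listed in decreasing order). Then, for each fixed $j\ge1$, as $n\to\infty$: (a) if $2$ is a resonance, then $n\theta_j^{(n)}\to(j-\tfrac12)\pi$; (b) if $2$ is nonresonant, then $n\theta_j^{(n)}\to j\pi$.
   Context: Jacobi parameters are bounded sequences $a_n>0$, $b_n\in\mathbb{R}$ ($n\ge 1$), with the convention $a_0=1$. The orthonormal polynomials $p_n$ are defined by $p_{-1}=0$, $p_0=1$ and $xp_n(x)=a_{n+1}p_{n+1}(x)+b_{n+1}p_n(x)+a_np_{n-1}(x)$, $n\ge 0$. Under the stated moment condition it is known that for each $\theta$ there is a (Jost) solution $u_n(e^{i\theta})$, $n\ge0$, of $a_nu_{n+1}+(b_n-E)u_n+a_{n-1}u_{n-1}=0$, $n\ge1$, at $E=2\cos\theta$, with $e^{-in\theta}u_n(e^{i\theta})\to1$ as $n\to\infty$, uniformly in $\theta$. The Jost function is $u=u_0$, viewed as a function on $[-2,2]$ through $E=2\cos\theta$, $0\le\theta\le\pi$; in particular its value at $E=2$ is $u_0(e^{i\theta})|_{\theta=0}$. One says there is a resonance at $2$ if the Jost function vanishes at $E=2$, and that $2$ is nonresonant otherwise. *)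

(* Defs.v *)
From HB Require Import structures.
From mathcomp Require Import all_boot all_order all_algebra.
From mathcomp Require Import polyrcf complex.
From mathcomp Require Import all_classical all_reals all_analysis.

Set Implicit Arguments.
Unset Strict Implicit.
Unset Printing Implicit Defensive.

Import Order.TTheory GRing.Theory Num.Theory.
Import numFieldNormedType.Exports.

Local Open Scope classical_set_scope.
Local Open Scope complex_scope.
Local Open Scope ring_scope.

(* The parameters are a 1, a 2, ... and b 1, b 2, ...; the value a 0 carries
   the convention a_0 = 1 and b 0 is never used. *)
Definition jacobi_parameters (R : realType) (a b : nat -> R) : Prop :=
  [/\ a 0%N = 1,
      forall n, (1 <= n)%N -> 0 < a n
    & exists M : R, forall n, (1 <= n)%N -> `|a n| <= M /\ `|b n| <= M].

(* The recursion x p_m = a_(m+1) p_(m+1) + b_(m+1) p_m + a_m p_(m-1), with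
   p_(-1) = 0, solved for p_(m+1). *)
Fixpoint orthopoly (R : realType) (a b : nat -> R) (n : nat) : {poly R} :=
  if n is m.+1 then
    (a m.+1)^-1 *: (('X - (b m.+1)%:P) * orthopoly a b m
                    - a m *: (if m is k.+1 then orthopoly a b k else 0))
  else 1.

(* E_1 > E_2 > ...: rootsR lists the real roots without repetition in
   increasing order, and E = 2 cos t with t real forces -2 <= E <= 2. *)
Definition zeros_below_2 (R : realType) (a b : nat -> R) (n : nat) : seq R :=
  rev [seq x <- rootsR (orthopoly a b n) | -2 <= x <= 2].

(* The angle of the j-th zero, j counted from 1; it is meaningful only when
   (1 <= j <= size (zeros_below_2 a b n))%N. *)
Definition zero_angle (R : realType) (a b : nat -> R) (n j : nat) : R :=
  acos (nth 0 (zeros_below_2 a b n) j.-1 / 2).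

Definition expi (R : realType) (t : R) : R[i] := cos t +i* sin t.

(* u t n stands for u_n(e^(it)). *)
Definition jost_solution (R : realType) (a b : nat -> R)
    (u : R -> nat -> R[i]) : Prop :=
  (forall t n, (1 <= n)%N ->
     (a n)%:C * u t n.+1 + (b n - 2 * cos t)%:C * u t n
     + (a n.-1)%:C * u t n.-1 = 0) /\
  (forall eps : R, 0 < eps -> exists N : nat, forall (n : nat) (t : R), (N <= n)%N ->
     `|expi (- (n%:R * t)) * u t n - 1| < eps%:C).

(* There is at most one jost_solution: the weighted Wronskian of two of them is
   constant in n and tends to 0, so they are proportional. Hence xget picks it as soon as it exists. *)
Definition jost_function (R : realType) (a b : nat -> R) (E : R) : R[i] :=
  xget (fun _ _ => 0) [set u | jost_solution a b u] (acos (E / 2)) 0%N.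

Definition resonance_at_2 (R : realType) (a b : nat -> R) : Prop :=
  jost_function a b 2 = 0.

(* Main.v *)
Require Import Defs.
From HB Require Import structures.
From mathcomp Require Import all_boot all_order all_algebra.
From mathcomp Require Import polyrcf complex.
From mathcomp Require Import all_classical all_reals all_analysis.
From mathcomp Require Import ring lra.

Import Order.TTheory GRing.Theory Num.Theory.
Import numFieldNormedType.Exports.

Local Open Scope classical_set_scope.
Local Open Scope ring_scope.

(** Write q_n = p_(n-1), so that q solves the same recursion as the Jost
    solution, with q_0 = 0 and q_1 = 1.  Everything is read off from the
    Wronskian (Casoratian) of q with one distinguished solution: the Jost
    solution psi at E = 2, which is real and tends to 1.

    Put V_n = a_n (q_(n+1) psi_n - q_n psi_(n+1)), a polynomial in E.  The
    recursion gives V_n = V_(n-1) - (2 - E) psi_n q_n and V_0 = psi_0, the value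
    of the Jost function at E = 2.  With w_n = q_n / psi_n (for large n) and
    c_n = a_n psi_n psi_(n+1) this becomes the first-order system
      V_n = V_(n-1) - (2 - E) psi_n^2 w_n,    w_(n+1) = w_n + V_n / c_n,
    whose coefficients tend to those of the free system (psi_n^2 = c_n = 1).
    The moment condition enters only through psi and through a_n -> 1.

    At E = 2 the Casoratian is constantly psi_0.  Hence w_n is constant in the
    resonant case and grows like psi_0 n in the nonresonant one.  At the scale
    E = 2 cos (y / n) a discrete Gronwall argument (gronwall_comparison,
    scaling_comparison) carries the free solution with these initial data all
    the way to index n, uniformly for y in a bounded interval:
      resonant:     w_n -> ka cos y,              n V_(n-1) -> - ka y sin y,
      nonresonant:  w_n / n -> psi_0 sin y / y,   V_(n-1) -> psi_0 cos y
    (resonant_scaling, nonresonant_scaling).  So the zeros of p_(n-1) accumulate,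
    in the variable y, at the zeros of cos y, respectively of sin y / y.

    That each limit point attracts exactly one zero follows from monotonicity.
    By the Christoffel-Darboux identity the Wronskian in E of q_n and V_(n-1)
    never vanishes (wronskian_casoratian).  Near a limit point V_(n-1) has no
    zero, so q_n / V_(n-1) is monotone there and q_n has at most one zero, by
    Rolle; a sign change gives one.  Away from the limit points q_n has no zero.
    Counting the zeros above each threshold identifies the j-th one
    (nth_zero_angle).

    The Jost solution itself is built by backward recursion from e^(iMt) at
    index M, letting M tend to infinity.  For the pair formed by u_n and
    x_n = a_n u_(n+1) - e^(it) u_n, the norm |u_n| + n |x_n| grows per backward
    step by a factor 1 + O(n (|a_(n-1) - 1| + |b_n|)) at most, and the moment
    condition is exactly the summability of these increments, uniformly in t. *)

Set Implicit Arguments.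
Unset Strict Implicit.

(** * Sequences whose increments are dominated by a telescoping sum *)

Lemma nonneg_nonincreasing_cvgn (R : realType) (r : nat -> R) :
  (forall k, 0 <= r k) -> (forall k, r k.+1 <= r k) -> cvgn r.
Proof.
move=> r0 rS; apply: nonincreasing_is_cvgn.
  by apply/nonincreasing_seqP.
by exists 0 => _ [k _ <-].
Qed.

(** Summability is expressed by a decreasing majorant r of the tails, which
    serves both as Cauchy bound and as rate of convergence: x + r is nonincreasing
    and bounded below, hence x converges. *)
Lemma bounded_variation_cvgn (R : realType) (x r : nat -> R) :
  (forall k, 0 <= r k) ->
  (forall k, `|x k.+1 - x k| <= r k - r k.+1) ->
  cvgn x /\ forall l, x @ \oo --> l -> `|l - x 0%N| <= r 0%N.
Proof.
move=> r0 xr.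
have rS k : r k.+1 <= r k by rewrite -subr_ge0; apply: le_trans (xr k).
have cr : cvgn r by exact: nonneg_nonincreasing_cvgn.
have xB k : `|x k - x 0%N| <= r 0%N - r k.
  elim: k => [|k IH]; first by rewrite !subrr normr0.
  rewrite -(subrKA (x k)); apply: le_trans (ler_normD _ _) _.
  by have := lerD (xr k) IH; lra.
have cxr : cvgn (fun k => x k + r k).
  apply: nonincreasing_is_cvgn.
    by apply/nonincreasing_seqP => k; have := xr k; rewrite ler_norml; lra.
  exists (x 0%N - r 0%N) => _ [k _ <-].
  by have := xB k; rewrite ler_norml; have := r0 k; lra.
split.
  have -> : x = (fun k => (x k + r k) - r k) by apply/funext => k; lra.
  exact: is_cvgB.
move=> l xl.
have : (fun k => `|x k - x 0%N|) @ \oo --> `|l - x 0%N|.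
  by apply: cvg_norm; apply: cvgB => //; exact: cvg_cst.
move=> h; rewrite -(cvg_lim _ h)//; apply: limr_le; first by apply: cvgP h.
by near=> k; apply: le_trans (xB k) _; have := r0 k; lra.
Unshelve. all: by end_near. Qed.

(** * Modulus and phase of complex numbers *)

Section Modulus.
Context {R : realType}.
Local Open Scope complex_scope.

(** The norm of R[i] takes its values in R[i]; estimates are done in R. *)
Definition cmod (z : R[i]) : R := Normc.normc z.

Lemma cmodE (z : R[i]) : `|z| = (cmod z)%:C.
Proof. by rewrite /cmod normc_def; case: z. Qed.

Lemma cmodM (z w : R[i]) : cmod (z * w) = cmod z * cmod w.
Proof. exact: Normc.normcM. Qed.

Lemma cmodD (z w : R[i]) : cmod (z + w) <= cmod z + cmod w.
Proof. exact: le_normcD. Qed.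

Lemma cmodN (z : R[i]) : cmod (- z) = cmod z.
Proof. exact: normcN. Qed.

Lemma cmodB (z w : R[i]) : cmod (z - w) <= cmod z + cmod w.
Proof. by rewrite -(cmodN w); exact: cmodD. Qed.

Lemma cmodV (z : R[i]) : cmod z^-1 = (cmod z)^-1.
Proof. exact: Normc.normcV. Qed.

Lemma cmodX (z : R[i]) n : cmod (z ^+ n) = cmod z ^+ n.
Proof.
elim: n => [|n IH]; first by rewrite !expr0 /cmod Normc.normc1.
by rewrite !exprS cmodM IH.
Qed.

Lemma cmod_real (x : R) : cmod x%:C = `|x|.
Proof. by rewrite /cmod /= expr0n /= addr0 sqrtr_sqr. Qed.

Lemma cmod_ge0 (z : R[i]) : 0 <= cmod z.
Proof. by case: z => x y; rewrite /cmod sqrtr_ge0. Qed.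

Lemma Re_le_cmod (z : R[i]) : `|complex.Re z| <= cmod z.
Proof.
case: z => x y; rewrite /cmod /= -sqrtr_sqr ler_sqrt ?addr_ge0 ?sqr_ge0//.
by rewrite lerDl sqr_ge0.
Qed.

Lemma Im_le_cmod (z : R[i]) : `|complex.Im z| <= cmod z.
Proof.
case: z => x y; rewrite /cmod /= -sqrtr_sqr ler_sqrt ?addr_ge0 ?sqr_ge0//.
by rewrite lerDr sqr_ge0.
Qed.

Lemma cmod_le_ReIm (z : R[i]) : cmod z <= `|complex.Re z| + `|complex.Im z|.
Proof.
have -> : z = (complex.Re z)%:C + ((complex.Im z)%:C * 'i).
  by rewrite [LHS]complexE mulrC.
have := cmodD (complex.Re z)%:C ((complex.Im z)%:C * 'i).
rewrite cmodM !cmod_real.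
have -> : cmod 'i = 1 by rewrite /cmod /= expr0n add0r expr1n sqrtr1.
by case: z => x y; rewrite mulr1 /=; simpc.
Qed.

Lemma cmod_expi (t : R) : cmod (expi t) = 1.
Proof. by rewrite /cmod /expi /= cos2Dsin2 sqrtr1. Qed.

Lemma expi_neq0 (t : R) : expi t != 0.
Proof.
apply/eqP => h; have := cmod_expi t; rewrite h /cmod Normc.normc0.
by move/eqP; rewrite eq_sym oner_eq0.
Qed.

Lemma expiD (s t : R) : expi (s + t) = expi s * expi t.
Proof. by rewrite /expi cosD sinD; simpc; congr (_ +i* _); ring. Qed.

Lemma expiN (t : R) : expi (- t) = (expi t)^-1.
Proof.
apply: (mulIf (expi_neq0 t)); rewrite -expiD addNr mulVf ?expi_neq0//.
by rewrite /expi cos0 sin0.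
Qed.

Lemma expiX (t : R) n : expi t ^+ n = expi (n%:R * t).
Proof.
elim: n => [|n IH]; first by rewrite expr0 mul0r /expi cos0 sin0.
by rewrite exprS IH -expiD; congr expi; rewrite -natr1; ring.
Qed.

Lemma expi_sum (t : R) : expi t + (expi t)^-1 = (2 * cos t)%:C.
Proof.
by rewrite -expiN /expi cosN sinN; simpc; congr (_ +i* _); ring.
Qed.

End Modulus.

(** * Construction of the Jost solution *)

Section JostConstruction.
Context {R : realType}.
Variables (a b : nat -> R).
Local Open Scope complex_scope.
Implicit Types (al : R[i]) (z : R[i] * R[i]).

(** The three-term recursion run downwards from n+1 to n, in the unknowns u_n
    and x_n = a_n u_(n+1) - al u_n with al = e^(it).  For the free recursion x_n
    is multiplied by al at each step, so x = 0 singles out the multiples of e^(int)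
    among all solutions. *)
Definition jost_step al n z : R[i] * R[i] :=
  let u := ((a n)^-1)%:C * ((al^-1 - (b n.+1)%:C) * z.1 - z.2) in
  (u, (a n)%:C * z.1 - al * u).

Fixpoint jost_descend al n k z : R[i] * R[i] :=
  if k is k'.+1 then jost_step al n (jost_descend al n.+1 k' z) else z.

(** Peels off the first backward step, so that descents from consecutive indices
    become descents from the same index with different initial data. *)
Lemma jost_descendS al n k z :
  jost_descend al n k.+1 z = jost_descend al n k (jost_step al (n + k) z).
Proof.
elim: k n => [|k IH] n; first by rewrite addn0.
rewrite -[LHS]/(jost_step al n (jost_descend al n.+1 k.+1 z)) IH.
by rewrite /= addSnnS.
Qed.

Lemma jost_stepB al n z w :
  jost_step al n (z - w) = jost_step al n z - jost_step al n w.
Proof.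
have e1 : (z - w).1 = z.1 - w.1 :> R[i] by [].
have e2 : (z - w).2 = z.2 - w.2 :> R[i] by [].
have eB (p q p' q' : R[i]) : (p, q) - (p', q') = (p - p', q - q') by [].
by rewrite /jost_step eB e1 e2; congr pair; ring.
Qed.

Lemma jost_descendB al n k z w :
  jost_descend al n k (z - w) = jost_descend al n k z - jost_descend al n k w.
Proof. by elim: k n => //= k IH n; rewrite IH jost_stepB. Qed.

(** In the free case |u_n| <= |u_(n+1)| + |x_(n+1)| and |x_n| = |x_(n+1)|, so
    the norm with weight n does not increase in a backward step. *)
Definition jost_norm n z : R := cmod z.1 + n%:R * cmod z.2.

Variables (ka d0 : R).
Hypotheses (a_gt0 : forall n, 0 < a n) (a_inv : forall n, (a n)^-1 <= ka).
Let d n : R := `|a n - 1| + `|b n.+1|.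
Hypothesis (d_le : forall n, d n <= d0).
Let K : R := 1 + 2 * ka + ka * d0.

Lemma jost_inva n : (a n)^-1 <= 1 + ka * `|a n - 1|.
Proof.
have -> : (a n)^-1 = 1 + (a n)^-1 * (1 - a n).
  by rewrite mulrBr mulVf ?gt_eqF// mulr1; lra.
rewrite lerD2l; apply: le_trans (ler_norm _) _.
by rewrite normrM distrC ler_pM// ger0_norm// invr_ge0 ltW.
Qed.

Lemma jost_inva_sub n : `|a n - (a n)^-1| <= (1 + ka) * `|a n - 1|.
Proof.
have -> : a n - (a n)^-1 = (1 + (a n)^-1) * (a n - 1).
  by rewrite mulrDl mul1r mulrBr mulVf ?gt_eqF// mulr1; lra.
rewrite normrM ler_wpM2r// ger0_norm ?lerD2l//.
by rewrite addr_ge0 ?invr_ge0 ?ltW.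
Qed.

Lemma jost_step_le al n z : cmod al = 1 ->
  cmod (jost_step al n z).1 <=
    (1 + ka * d n) * ((1 + d n) * cmod z.1 + cmod z.2) /\
  cmod (jost_step al n z).2 <=
    (1 + 2 * ka) * d n * cmod z.1 + (1 + ka * d n) * cmod z.2.
Proof.
move=> al1.
have al0 : al != 0.
  by apply/eqP => h; move: al1; rewrite h /cmod Normc.normc0 => /eqP; rewrite eq_sym oner_eq0.
have ia0 : 0 <= (a n)^-1 by rewrite invr_ge0 ltW.
have ka0 : 0 <= ka by apply: le_trans (a_inv n).
have x0 := cmod_ge0 z.1; have y0 := cmod_ge0 z.2.
have da : `|a n - 1| <= d n by rewrite /d lerDl.
have db : `|b n.+1| <= d n by rewrite /d lerDr.
have dE : d n = `|a n - 1| + `|b n.+1| by [].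
have ia := jost_inva n; have ias := jost_inva_sub n; have iak := a_inv n.
have ian : (a n)^-1 <= 1 + ka * d n.
  by apply: le_trans ia _; rewrite lerD2l ler_wpM2l.
split.
  rewrite /jost_step /= cmodM cmod_real ger0_norm//.
  apply: ler_pM => //; first exact: cmod_ge0.
  apply: le_trans (cmodB _ _) _; rewrite lerD2r cmodM ler_wpM2r//.
  apply: le_trans (cmodB _ _) _; rewrite cmodV al1 invr1 cmod_real.
  by rewrite lerD2l.
have -> : (jost_step al n z).2 =
    ((a n - (a n)^-1)%:C + al * ((a n)^-1)%:C * (b n.+1)%:C) * z.1
    + al * ((a n)^-1)%:C * z.2.
  rewrite /jost_step /= rmorphB /=.
  have -> : al * (((a n)^-1)%:C * ((al^-1 - (b n.+1)%:C) * z.1 - z.2)) =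
     ((a n)^-1)%:C * ((al * al^-1 - al * (b n.+1)%:C) * z.1 - al * z.2) by ring.
  by rewrite divff//; ring.
apply: le_trans (cmodD _ _) _; rewrite !cmodM al1 mul1r !cmod_real.
rewrite (ger0_norm ia0) lerD ?ler_wpM2r//.
apply: le_trans (cmodD _ _) _; rewrite !cmodM al1 mul1r !cmod_real (ger0_norm ia0).
have : (a n)^-1 * `|b n.+1| <= ka * `|b n.+1| by rewrite ler_wpM2r.
by move: ias; rewrite dE; have := normr_ge0 (a n - 1); have := normr_ge0 (b n.+1); nra.
Qed.

(** The coupling x_(n+1) -> u_n costs nothing because the weight drops from
    n+1 to n; what remains is proportional to the size of the perturbation. *)
Lemma jost_step_norm al n z : cmod al = 1 ->
  jost_norm n (jost_step al n z) <= (1 + K * (n.+1%:R * d n)) * jost_norm n.+1 z.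
Proof.
move=> al1; have [h1 h2] := jost_step_le n z al1.
have ka0 : 0 <= ka by apply: le_trans (a_inv n); rewrite invr_ge0 ltW.
have x0 := cmod_ge0 z.1; have y0 := cmod_ge0 z.2.
rewrite /jost_norm; move: h1 h2 x0 y0.
set u := cmod _; set x := cmod _; set y := cmod _; set v := cmod _ => h1 h2 x0 y0.
have n0 : 0 <= n%:R :> R by [].
have dn0 : 0 <= d n by rewrite addr_ge0.
have h3 : n%:R * v <= n%:R * ((1 + 2 * ka) * d n * x + (1 + ka * d n) * y) by rewrite ler_wpM2l.
apply: le_trans (lerD h1 h3) _; rewrite -natr1 /K.
have d2 : 0 <= ka * (d0 - d n) by rewrite mulr_ge0// subr_ge0.
set m := n%:R in n0 h3 *; set D := d n in h1 h2 h3 dn0 d2 *.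
have p1 : 0 <= (ka * (d0 - D)) * (D * x) by rewrite mulr_ge0// mulr_ge0.
have p2 : 0 <= (ka * d0) * (D * x) * m.
  rewrite !mulr_ge0//; exact: le_trans dn0 (d_le n).
have p3 : 0 <= D * y * (m + 1) ^+ 2 by rewrite !mulr_ge0// addr_ge0.
have p5 : 0 <= (D * y * (m + 1) ^+ 2) * (ka * d0).
  by rewrite mulr_ge0// mulr_ge0//; exact: le_trans dn0 (d_le n).
have p6 : 0 <= ka * (D * x) by rewrite !mulr_ge0.
have p7 : 0 <= ka * (D * y) by rewrite !mulr_ge0.
(* The two sides differ by a sum of nonnegative terms. *)
suff : 0 <= (ka * (d0 - D)) * (D * x) + (ka * d0) * (D * x) * m + ka * (D * x)
  + D * y * (m + 1) ^+ 2 + (D * y * (m + 1) ^+ 2) * (ka * d0)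
  + (2 * (m + 1) ^+ 2 - (m + 1)) * (ka * (D * y)) by lra.
do ?[apply: addr_ge0 => //]; apply: mulr_ge0 => //.
by rewrite subr_ge0; nra.
Qed.

Variable rho : nat -> R.
Hypotheses (rho_ge0 : forall n, 0 <= rho n)
  (d_rho : forall n, n.+1%:R * d n <= rho n - rho n.+1).

Lemma jostK_ge0 : 0 <= K.
Proof.
have ka0 : 0 <= ka by apply: le_trans (a_inv 0); rewrite invr_ge0 ltW.
have d00 : 0 <= d0 by apply: le_trans (d_le 0); rewrite /d addr_ge0.
by rewrite /K !addr_ge0// mulr_ge0.
Qed.

Lemma rho_nonincreasing n k : rho (n + k) <= rho n.
Proof.
elim: k => [|k IH]; rewrite ?addn0// addnS; apply: le_trans IH.
rewrite -subr_ge0; apply: le_trans (d_rho _).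
by rewrite mulr_ge0// /d addr_ge0.
Qed.

(** The product of the growth factors is dominated by the exponential of the
    telescoping sum of the increments of rho. *)
Lemma jost_descend_norm al n k z : cmod al = 1 ->
  jost_norm n (jost_descend al n k z) <= expR (K * rho 0%N) * jost_norm (n + k) z.
Proof.
move=> al1.
have norm_ge0 m w : 0 <= jost_norm m w.
  by rewrite /jost_norm addr_ge0 ?mulr_ge0 ?cmod_ge0.
suff h : jost_norm n (jost_descend al n k z) <=
    expR (K * (rho n - rho (n + k))) * jost_norm (n + k) z.
  apply: le_trans h _; rewrite ler_wpM2r// ler_expR ler_wpM2l ?jostK_ge0//.
  rewrite -{1}(add0n n); have := rho_nonincreasing 0 n; have := rho_ge0 (n + k).
  by rewrite !add0n; lra.
elim: k n => [|k IH] n; first by rewrite addn0 subrr mulr0 expR0 mul1r.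
rewrite -[jost_descend _ _ _ _]/(jost_step al n (jost_descend al n.+1 k z)).
apply: le_trans (jost_step_norm _ _ al1) _.
have -> : K * (rho n - rho (n + k.+1)) =
   K * (rho n - rho n.+1) + K * (rho n.+1 - rho (n.+1 + k)) by rewrite addSnnS; ring.
rewrite expRD -mulrA; apply: ler_pM => //.
- by rewrite addr_ge0// mulr_ge0 ?jostK_ge0// mulr_ge0// addr_ge0.
- apply: le_trans (expR_ge1Dx _); rewrite lerD2l ler_wpM2l ?jostK_ge0//.
- by rewrite -addSnnS.
Qed.

(** The value at n of the solution that coincides with e^(imt) at m = n + k and
    has x_m = 0 there. *)
Definition jost_trunc t n k : R[i] :=
  (jost_descend (expi t) n k (expi t ^+ (n + k), 0)).1.

Let C := expR (K * rho 0%N) * K.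

(** By linearity the difference of two consecutive truncations descends from
    the error made by the free solution in a single step. *)
Lemma jost_truncB t n k :
  cmod (jost_trunc t n k.+1 - jost_trunc t n k) <= C * (rho (n + k) - rho (n + k.+1)).
Proof.
rewrite /jost_trunc jost_descendS; set al := expi t.
have al1 : cmod al = 1 by exact: cmod_expi.
have al0 : al != 0 by exact: expi_neq0.
set M := (n + k)%N.
set z := jost_step al M (al ^+ (n + k.+1), 0).
have -> : (jost_descend al n k z).1 - (jost_descend al n k (al ^+ M, 0)).1
   = (jost_descend al n k (z - (al ^+ M, 0))).1 by rewrite jost_descendB.
apply: (@le_trans _ _ (jost_norm n (jost_descend al n k (z - (al ^+ M, 0))))).
  by rewrite /jost_norm lerDl mulr_ge0// cmod_ge0.
apply: le_trans (jost_descend_norm _ _ _ al1) _.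
rewrite /C -mulrA ler_wpM2l ?expR_ge0// -/M addnS -/M.
apply: (@le_trans _ _ (K * (M.+1%:R * d M))); last first.
  by rewrite ler_wpM2l ?jostK_ge0.
have -> : jost_norm M (z - (al ^+ M, 0)) =
    cmod (z.1 - al ^+ M) + M%:R * cmod (z.2 - 0) by [].
rewrite (subr0 z.2) /z /jost_step /=.
have ia0 : 0 <= (a M)^-1 by rewrite invr_ge0 ltW.
have -> : ((a M)^-1)%:C * ((al^-1 - (b M.+1)%:C) * al ^+ (n + k.+1) - 0) - al ^+ M
    = al ^+ M * (((a M)^-1 - 1)%:C - ((a M)^-1)%:C * al * (b M.+1)%:C).
  rewrite addnS exprS -/M rmorphB /= subr0.
  have -> : (al^-1 - (b M.+1)%:C) * (al * al ^+ M) =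
     (al * al^-1 - al * (b M.+1)%:C) * al ^+ M by ring.
  by rewrite divff//; ring.
have -> : (a M)%:C * al ^+ (n + k.+1) -
    al * (((a M)^-1)%:C * ((al^-1 - (b M.+1)%:C) * al ^+ (n + k.+1) - 0))
    = al ^+ M.+1 * ((a M - (a M)^-1)%:C + ((a M)^-1)%:C * al * (b M.+1)%:C).
  rewrite addnS exprS -/M rmorphB /= subr0.
  have -> : (al^-1 - (b M.+1)%:C) * (al * al ^+ M) =
     (al * al^-1 - al * (b M.+1)%:C) * al ^+ M by ring.
  by rewrite divff//; ring.
rewrite !cmodM !cmodX al1 !expr1n !mul1r.
have h1 : cmod (((a M)^-1 - 1)%:C - ((a M)^-1)%:C * al * (b M.+1)%:C) <= ka * d M.
  apply: le_trans (cmodB _ _) _; rewrite !cmodM al1 !cmod_real (ger0_norm ia0) mulr1.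
  have -> : (a M)^-1 - 1 = (a M)^-1 * (1 - a M) by rewrite mulrBr mulVf ?gt_eqF// mulr1.
  rewrite normrM distrC (ger0_norm ia0) -mulrDr.
  by rewrite ler_wpM2r// addr_ge0.
have h2 : cmod ((a M - (a M)^-1)%:C + ((a M)^-1)%:C * al * (b M.+1)%:C) <= (1 + 2 * ka) * d M.
  apply: le_trans (cmodD _ _) _; rewrite !cmodM al1 !cmod_real (ger0_norm ia0) mulr1.
  have : (a M)^-1 * `|b M.+1| <= ka * `|b M.+1| by rewrite ler_wpM2r.
  have ka0 : 0 <= ka by exact: le_trans (a_inv M).
  have := jost_inva_sub M; rewrite /d.
  by have := normr_ge0 (a M - 1); have := normr_ge0 (b M.+1); nra.
have h3 : M%:R * cmod ((a M - (a M)^-1)%:C + ((a M)^-1)%:C * al * (b M.+1)%:C)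
   <= M%:R * ((1 + 2 * ka) * d M) by rewrite ler_wpM2l.
apply: le_trans (lerD h1 h3) _; rewrite /K -natr1.
have ka0 : 0 <= ka by exact: le_trans (a_inv M).
have d00 : 0 <= d0 by apply: le_trans (d_le M); rewrite /d addr_ge0.
have dM0 : 0 <= d M by rewrite /d addr_ge0.
have m0 : 0 <= M%:R :> R by [].
have p1 : 0 <= ka * d M by rewrite mulr_ge0.
have p2 : 0 <= ka * d0 * ((M%:R + 1) * d M) by rewrite !mulr_ge0// addr_ge0.
by lra.
Qed.

Definition jost_limit t n : R[i] :=
  limn (fun k => complex.Re (jost_trunc t n k))
  +i* limn (fun k => complex.Im (jost_trunc t n k)).

Lemma jost_limit_spec t n :
  [/\ (fun k => complex.Re (jost_trunc t n k)) @ \oo --> complex.Re (jost_limit t n),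
      (fun k => complex.Im (jost_trunc t n k)) @ \oo --> complex.Im (jost_limit t n) &
      cmod (jost_limit t n - expi t ^+ n) <= 2 * (C * rho n)].
Proof.
have C0 : 0 <= C by rewrite /C mulr_ge0 ?expR_ge0 ?jostK_ge0.
have r0 k : 0 <= C * rho (n + k) by rewrite mulr_ge0.
have ReB (z w : R[i]) : complex.Re z - complex.Re w = complex.Re (z - w) by case: z; case: w.
have ImB (z w : R[i]) : complex.Im z - complex.Im w = complex.Im (z - w) by case: z; case: w.
have [c1 h1] := @bounded_variation_cvgn R (fun k => complex.Re (jost_trunc t n k)) _ r0
  (fun k => ltac:(rewrite ReB -mulrBr; exact: le_trans (Re_le_cmod _) (jost_truncB t n k))).
have [c2 h2] := @bounded_variation_cvgn R (fun k => complex.Im (jost_trunc t n k)) _ r0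
  (fun k => ltac:(rewrite ImB -mulrBr; exact: le_trans (Im_le_cmod _) (jost_truncB t n k))).
split => //.
have -> : expi t ^+ n = jost_trunc t n 0 by rewrite /jost_trunc addn0.
apply: le_trans (cmod_le_ReIm _) _; rewrite -ReB -ImB.
by have := h1 _ c1; have := h2 _ c2; rewrite addn0 /=; lra.
Qed.

(** The indices k, k+1, k+2 make the three truncations start from the same
    place, so they belong to one exact solution. *)
Lemma jost_trunc_rec t n k :
  (a n.+1)%:C * jost_trunc t n.+2 k
  + (b n.+1 - 2 * cos t)%:C * jost_trunc t n.+1 k.+1
  + (a n)%:C * jost_trunc t n k.+2 = 0.
Proof.
have aK m : (a m)%:C * ((a m)^-1)%:C = 1 :> R[i].
  by rewrite -rmorphM /= divff ?gt_eqF.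
rewrite /jost_trunc !addSnnS; set Z := expi t ^+ _.
rewrite /= /jost_step /= rmorphB /= -expi_sum.
set w := jost_descend _ _ _ _.
set u := (_ * (_ * w.1 - w.2)); set v := (u in _ - expi t * u).
have -> : (a n)%:C * (((a n)^-1)%:C * (((expi t)^-1 - (b n.+1)%:C) * u - ((a n.+1)%:C * w.1 - expi t * u)))
  = ((a n)%:C * ((a n)^-1)%:C) * (((expi t)^-1 - (b n.+1)%:C) * u - ((a n.+1)%:C * w.1 - expi t * u)) by ring.
rewrite aK; ring.
Qed.

Lemma jost_limit_solution : rho @ \oo --> (0 : R) -> jost_solution a b jost_limit.
Proof.
move=> rho_cvg0; split.
  move=> t [//|n] _; rewrite /=.
  have [r0 i0 _] := jost_limit_spec t n.
  have [r1 i1 _] := jost_limit_spec t n.+1.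
  have [r2 i2 _] := jost_limit_spec t n.+2.
  have shiftn m (f : nat -> R) (l : R) : f @ \oo --> l -> (fun k => f (k + m)%N) @ \oo --> l.
    by move=> h; rewrite cvg_shiftn.
  have {}r0 := shiftn 2%N _ _ r0; have {}i0 := shiftn 2%N _ _ i0.
  have {}r1 := shiftn 1%N _ _ r1; have {}i1 := shiftn 1%N _ _ i1.
  have key (f0 f1 f2 : nat -> R) (l0 l1 l2 : R) : f0 @ \oo --> l0 -> f1 @ \oo --> l1 ->
      f2 @ \oo --> l2 ->
      (forall k, a n.+1 * f2 k + (b n.+1 - 2 * cos t) * f1 k + a n * f0 k = 0) ->
      a n.+1 * l2 + (b n.+1 - 2 * cos t) * l1 + a n * l0 = 0.
    move=> h0 h1 h2 h.
    have : (fun k => a n.+1 * f2 k + (b n.+1 - 2 * cos t) * f1 k + a n * f0 k) @ \oo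
      --> a n.+1 * l2 + (b n.+1 - 2 * cos t) * l1 + a n * l0.
      by apply: cvgD; [apply: cvgD|]; apply: cvgMr.
    rewrite (_ : (fun k => _) = cst 0); last by apply/funext => k; exact: h.
    by move=> hc; apply/esym; apply: (cvg_unique _ (cvg_cst 0) hc).
  have eqR := key _ _ _ _ _ _ r0 r1 r2; have eqI := key _ _ _ _ _ _ i0 i1 i2.
  move: eqR eqI.
  case: (jost_limit t n) => x0 y0; case: (jost_limit t n.+1) => x1 y1.
  case: (jost_limit t n.+2) => x2 y2 /= eqR eqI; simpc.
  congr (_ +i* _); [apply: eqR|apply: eqI] => k.
  - have := congr1 (@complex.Re R) (jost_trunc_rec t n k); rewrite addn1 addn2.
    by case: (jost_trunc t n.+2 k) => ? ?; case: (jost_trunc t n.+1 k.+1) => ? ?;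
      case: (jost_trunc t n k.+2) => ? ? /=; lra.
  - have := congr1 (@complex.Im R) (jost_trunc_rec t n k); rewrite addn1 addn2.
    by case: (jost_trunc t n.+2 k) => ? ?; case: (jost_trunc t n.+1 k.+1) => ? ?;
      case: (jost_trunc t n k.+2) => ? ? /=; lra.
move=> eps eps0.
have C0 : 0 <= C by rewrite /C mulr_ge0 ?expR_ge0 ?jostK_ge0.
have : \forall n \near \oo, `|0 - rho n| < eps / (2 * C + 1).
  by move/cvgrPdist_lt : rho_cvg0; apply; rewrite divr_gt0//; lra.
move=> [N _ hN]; exists N => n t Nn.
have [_ _ h] := jost_limit_spec t n.
have := hN n Nn; rewrite /= sub0r normrN ger0_norm// ltr_pdivlMr; last by lra.
move=> h2; rewrite cmodE ltcR.
have -> : expi (- (n%:R * t)) * jost_limit t n - 1 = expi (- (n%:R * t)) * (jost_limit t n - expi t ^+ n).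
  by rewrite mulrBr expiX -expiD addNr /expi cos0 sin0.
rewrite cmodM cmod_expi mul1r; apply: le_lt_trans h _.
by have := rho_ge0 n; nra.
Qed.

End JostConstruction.

(** * The Jost solution at the edge of the spectrum *)

(** The recursion pairs a_n with b_(n+1).  For n >= 1 the shift costs a factor 2,
    since n + 1 <= 2 n; for n = 0 the term with a vanishes because a_0 = 1. *)
Lemma moment_majorant {R : realType} (a b : nat -> R) : a 0%N = 1 ->
  cvgn (series (fun n : nat => n%:R * (`|a n - 1| + `|b n|))) ->
  exists rho : nat -> R,
    [/\ forall n, 0 <= rho n, rho @ \oo --> (0 : R) &
        forall n, n.+1%:R * (`|a n - 1| + `|b n.+1|) <= rho n - rho n.+1].
Proof.
move=> a0; set s := (fun n : nat => _) => cs.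
have s0 n : 0 <= s n by rewrite /s mulr_ge0// addr_ge0.
pose r n := limn (series s) - series s n.
have rS n : r n - r n.+1 = s n.
  by rewrite /r /series /= big_nat_recr//=; lra.
have r_ge0 n : 0 <= r n.
  rewrite /r subr_ge0; apply: nondecreasing_cvgn_le => //.
  by apply/nondecreasing_seqP => k; rewrite /series /= big_nat_recr//= lerDl.
have rc : r @ \oo --> (0 : R).
  rewrite /r -(subrr (limn (series s))); apply: cvgB => //; exact: cvg_cst.
exists (fun n => 2 * r n + r n.+1); split.
- by move=> n; rewrite addr_ge0// mulr_ge0.
- rewrite -(addr0 0) -{1}(mulr0 2); apply: cvgD; first exact: cvgMr.
  by move: rc; rewrite -cvg_shiftS.
move=> n; have -> : 2 * r n + r n.+1 - (2 * r n.+1 + r n.+2) = 2 * s n + s n.+1.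
  by rewrite -!rS; lra.
have an : n.+1%:R * `|a n - 1| <= 2 * (n%:R * `|a n - 1|).
  case: n => [|n]; first by rewrite a0 subrr normr0 !mulr0.
  by rewrite mulrA ler_wpM2r// -!natr1; have := ler0n R n; lra.
rewrite /s !mulrDr; apply: (@le_trans _ _ (2 * (n%:R * `|a n - 1|) + n.+1%:R * `|b n.+1|)).
  by rewrite lerD2r.
have := mulr_ge0 (ler0n R n) (normr_ge0 (b n)).
have := mulr_ge0 (ler0n R n.+1) (normr_ge0 (a n.+1 - 1)).
lra.
Qed.

Lemma jacobi_a_gt0 {R : realType} (a b : nat -> R) :
  jacobi_parameters a b -> forall n, 0 < a n.
Proof. by move=> [a0 ap _] [|n]; [rewrite a0|exact: ap]. Qed.

Lemma jacobi_a_cvg1 {R : realType} (a b : nat -> R) : jacobi_parameters a b ->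
  cvgn (series (fun n : nat => n%:R * (`|a n - 1| + `|b n|))) ->
  a @ \oo --> (1 : R).
Proof.
move=> [a0 _ _] /(moment_majorant a0) [rho [r0 rc rd]].
apply/cvgrPdist_lt => e e0; move/cvgrPdist_lt : rc => /(_ e e0) [N _ hN].
exists N => // n /hN /=; rewrite sub0r normrN ger0_norm// distrC; apply: le_lt_trans.
have := rd n; have := r0 n.+1; rewrite -natr1.
have := mulr_ge0 (ler0n R n) (normr_ge0 (a n - 1)).
have := mulr_ge0 (ler0n R n) (normr_ge0 (b n.+1)).
have := normr_ge0 (b n.+1); have := normr_ge0 (a n - 1); lra.
Qed.

Lemma jost_solution_exists {R : realType} (a b : nat -> R) : jacobi_parameters a b ->
  cvgn (series (fun n : nat => n%:R * (`|a n - 1| + `|b n|))) ->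
  exists u, jost_solution a b u.
Proof.
move=> hab hsum; have a_gt0 := jacobi_a_gt0 hab.
have ac := jacobi_a_cvg1 hab hsum.
have [a0 _ _] := hab; have [rho [r0 rc rd]] := moment_majorant a0 hsum.
have [M [_ hM]] : bounded_fun (fun n => (a n)^-1).
  by apply/cvg_seq_bounded/cvgP; apply: (cvgV (oner_neq0 R) ac).
pose ka := M + 1.
have a_inv n : (a n)^-1 <= ka.
  apply: le_trans (ler_norm _) _; apply: (hM ka) => //; rewrite /ka; lra.
have d_le n : `|a n - 1| + `|b n.+1| <= rho 0%N.
  apply: (@le_trans _ _ (rho n)).
    have := rd n; have := r0 n.+1; rewrite -natr1.
    have := mulr_ge0 (ler0n R n) (addr_ge0 (normr_ge0 (a n - 1)) (normr_ge0 (b n.+1))).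
    lra.
  elim: n => // n IH; apply: le_trans IH; rewrite -subr_ge0.
  by apply: le_trans (rd n); rewrite mulr_ge0// addr_ge0.
exists (jost_limit a b).
by apply: (jost_limit_solution a_gt0 a_inv d_le r0 rd rc).
Qed.

(** The Casoratian with psi is constant and tends to 0, so eta is proportional
    to psi; comparing the limits, the factor is 0.  The recursion runs backwards
    because a_n does not vanish. *)
Lemma vanishing_solution0 {R : realType} (a b : nat -> R) (psi eta : nat -> R) :
  (forall n, 0 < a n) -> a @ \oo --> (1 : R) ->
  (forall n, a n.+1 * psi n.+2 + (b n.+1 - 2) * psi n.+1 + a n * psi n = 0) ->
  (forall n, a n.+1 * eta n.+2 + (b n.+1 - 2) * eta n.+1 + a n * eta n = 0) ->
  psi @ \oo --> (1 : R) -> eta @ \oo --> (0 : R) -> forall n, eta n = 0.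
Proof.
move=> a_gt0 ac psiE etaE psi1 eta0.
pose W n := a n * (eta n.+1 * psi n - eta n * psi n.+1).
have WS n : W n.+1 = W n.
  rewrite /W; have h1 : a n.+1 * psi n.+2 = - (b n.+1 - 2) * psi n.+1 - a n * psi n.
    by have := psiE n; lra.
  have h2 : a n.+1 * eta n.+2 = - (b n.+1 - 2) * eta n.+1 - a n * eta n.
    by have := etaE n; lra.
  have -> : a n.+1 * (eta n.+2 * psi n.+1 - eta n.+1 * psi n.+2) =
    (a n.+1 * eta n.+2) * psi n.+1 - eta n.+1 * (a n.+1 * psi n.+2) by ring.
  by rewrite h1 h2; ring.
have W0 n : W n = W 0%N by elim: n => // n IH; rewrite WS.
have Wc : W @ \oo --> (0 : R).
  have -> : 0 = 1 * (0 * 1 - 0 * 1) :> R by ring.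
  apply: cvgM => //; apply: cvgB; apply: cvgM => //.
    by move: eta0; rewrite -cvg_shiftS.
  by move: psi1; rewrite -cvg_shiftS.
have {}W0 n : W n = 0.
  apply: (@cvg_unique _ (@Rhausdorff R) (W @ \oo)) => //.
  rewrite (_ : W = cst (W n)); first exact: cvg_cst.
  by apply/funext => k; rewrite /= !W0.
have [N _ hN] : \forall n \near \oo, 2^-1 < psi n.
  by apply: (cvgr_gt (1 : R)) => //; lra.
have psi_gt0 n : (N <= n)%N -> 0 < psi n by move=> /hN /=; lra.
have ratio n : eta (N + n)%N / psi (N + n)%N = eta N / psi N.
  elim: n => [|n IH]; first by rewrite addn0.
  rewrite -IH addnS; have p1 := psi_gt0 _ (leq_addr n N).
  have p2 := psi_gt0 _ (leq_addr n.+1 N); rewrite addnS in p2.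
  apply/eqP; rewrite eqr_div ?(gt_eqF p1) ?(gt_eqF p2)// -subr_eq0.
  have := W0 (N + n)%N; rewrite /W => /eqP.
  by rewrite mulf_eq0 gt_eqF.
have rc : (fun n => eta (N + n)%N / psi (N + n)%N) @ \oo --> (0 : R).
  have -> : 0 = 0 / 1 :> R by rewrite mul0r.
  have sh (f : nat -> R) (l : R) : f @ \oo --> l -> (fun n => f (N + n)%N) @ \oo --> l.
    move=> h; have -> : (fun n => f (N + n)%N) = (fun n => f (n + N)%N).
      by apply/funext => n; rewrite addnC.
    by rewrite cvg_shiftn.
  by apply: cvgM; [exact: sh|apply: cvgV => //; exact: sh].
have etaN0 : eta N / psi N = 0.
  apply: (@cvg_unique _ (@Rhausdorff R) ((fun n => eta (N + n)%N / psi (N + n)%N) @ \oo)) => //.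
  by rewrite (_ : (fun n => _) = cst (eta N / psi N)); [exact: cvg_cst|apply/funext].
have tail n : (N <= n)%N -> eta n = 0.
  move=> Nn; have := ratio (n - N)%N; rewrite subnKC// etaN0 => /eqP.
  by rewrite mulf_eq0 invr_eq0 [psi n == 0]gt_eqF ?psi_gt0// orbF => /eqP.
have back k n : (N <= n + k)%N -> eta n = 0 /\ eta n.+1 = 0.
  elim: k n => [|k IH] n Nk.
    by rewrite addn0 in Nk; rewrite !tail// leqW.
  have [h1 h2] := IH n.+1 ltac:(by rewrite addSnnS).
  split => //; have := etaE n; rewrite h1 h2 !mulr0 !add0r => /eqP.
  by rewrite mulf_eq0 gt_eqF//= => /eqP.
by move=> n; have [] := back N n (leq_addl _ _).
Qed.

(** The imaginary part of a Jost solution at t = 0 is a vanishing solution of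
    the real recursion, so resonance can be read off from the real part. *)
Lemma jost_solution_at_2 {R : realType} (a b : nat -> R) : jacobi_parameters a b ->
  cvgn (series (fun n : nat => n%:R * (`|a n - 1| + `|b n|))) ->
  exists psi : nat -> R,
    [/\ forall n, a n.+1 * psi n.+2 + (b n.+1 - 2) * psi n.+1 + a n * psi n = 0,
        psi @ \oo --> (1 : R) &
        resonance_at_2 a b <-> psi 0%N = 0].
Proof.
move=> hab hsum; have a_gt0 := jacobi_a_gt0 hab.
have ac := jacobi_a_cvg1 hab hsum.
have := xgetPex (fun _ _ => 0) (jost_solution_exists hab hsum).
rewrite /resonance_at_2 /jost_function divff// acos1.
move: (xget _ _) => u [urec ulim].
pose psi n := complex.Re (u 0 n); pose eta n := complex.Im (u 0 n).
have rec n : a n.+1 * psi n.+2 + (b n.+1 - 2) * psi n.+1 + a n * psi n = 0 /\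
    a n.+1 * eta n.+2 + (b n.+1 - 2) * eta n.+1 + a n * eta n = 0.
  have := urec 0 n.+1 isT; rewrite /= cos0 mulr1 /psi /eta.
  case: (u 0 n.+2) => x2 y2; case: (u 0 n.+1) => x1 y1; case: (u 0 n) => x0 y0 h.
  have := congr1 (@complex.Im R) h; have := congr1 (@complex.Re R) h.
  by rewrite /= => ? ?; split; lra.
have lim (e : R) : 0 < e -> exists N, forall n, (N <= n)%N -> cmod (u 0 n - 1) < e.
  move=> /ulim [N hN]; exists N => k /hN - /(_ 0).
  rewrite mulr0 oppr0 /expi cos0 sin0 mul1r => h.
  by rewrite -ltcR -cmodE.
have psi1 : psi @ \oo --> (1 : R).
  apply/cvgrPdist_lt => e /lim [N hN]; exists N => // n /hN.
  apply: le_lt_trans; rewrite distrC; apply: le_trans (Re_le_cmod _).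
  by rewrite /psi; case: (u 0 n).
have eta0 : eta @ \oo --> (0 : R).
  apply/cvgrPdist_lt => e /lim [N hN]; exists N => // n /hN.
  apply: le_lt_trans; rewrite distrC; apply: le_trans (Im_le_cmod _).
  by rewrite /eta; case: (u 0 n) => x y /=; rewrite !subr0.
have etaE := vanishing_solution0 a_gt0 ac (fun n => (rec n).1) (fun n => (rec n).2) psi1 eta0.
exists psi; split => //; first by move=> n; have [] := rec n.
split; first by rewrite /psi => ->.
move: (etaE 0%N); rewrite /psi /eta.
by case: (u 0 0%N) => x y /= -> ->.
Qed.

(** * Counting zeros with a non-vanishing Wronskian *)

(** Rolle for the quotient P / Q. *)
Lemma wronskian_common_root {R : realType} (P Q : {poly R}) (x y : R) : x < y ->
  P.[x] = 0 -> P.[y] = 0 -> (forall c, x <= c <= y -> Q.[c] != 0) ->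
  exists c, P^`().[c] * Q.[c] - P.[c] * Q^`().[c] = 0.
Proof.
move=> xy Px Py Q0.
pose f c := P.[c] * (Q.[c])^-1.
have df c : x <= c <= y -> is_derive c (1 : R) f
    (P.[c] * - ((Q.[c])^-2 * Q^`().[c]) + (Q.[c])^-1 * P^`().[c]).
  move=> /Q0 Qc.
  have h1 := is_derive_poly P c; have h2 := is_derive_poly Q c.
  have h3 := is_deriveV Qc h2.
  have h4 := is_deriveM h1 h3.
  have -> : f = horner P * (fun y => (Q.[y])^-1) by [].
  apply: (is_derive_eq h4).
  by rewrite /GRing.scale /=; ring.
have [c cxy dc] : exists2 c, c \in `]x, y[ & is_derive c (1 : R) f 0.
  apply: Rolle => //.
  - by move=> c; rewrite in_itv /= => /andP[xc cy]; have [] := df c ltac:(rewrite !ltW).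
  - apply: derivable_within_continuous => c; rewrite in_itv /= => h.
    by have [] := df c h.
  - by rewrite /f Px Py !mul0r.
move: cxy; rewrite in_itv /= => /andP[xc cy].
have xcy : x <= c <= y by rewrite !ltW.
exists c; have := df c xcy; have Qc := Q0 c xcy => -[_ e1].
have [_ e2] := dc; move: e1; rewrite e2 => e3.
have : Q.[c] ^+ 2 * 0 = Q.[c] ^+ 2 *
   (P.[c] * - ((Q.[c])^-2 * Q^`().[c]) + (Q.[c])^-1 * P^`().[c]) by rewrite {1}e3.
by rewrite mulr0 => ->; field.
Qed.

(** Turns the position of an entry in a decreasing list into a count of the
    entries above a threshold; counts are additive, positions are not. *)
Lemma count_decreasing_nth {R : realType} (s : seq R) (c : R) i :
  sorted (fun x y => y < x) s -> (i < size s)%N ->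
  (c <= nth 0 s i) = (i < count (fun x => (c <= x)%R) s)%N.
Proof.
have tr : transitive (fun x y : R => y < x) by move=> y x z xy yz; exact: lt_trans yz xy.
elim: s i => // x s IH i /= ps.
have ss : sorted (fun x y : R => y < x) s by exact: path_sorted ps.
have := order_path_min tr ps => /allP xs.
case: i => [|i] /= si; case: (leP c x) => cx /=.
- by rewrite add1n.
- rewrite add0n; apply/esym/negbTE; rewrite -leqNgt leqn0 -leqn0 leqNgt -has_count.
  by apply/hasPn => y /xs yx; rewrite -ltNge; exact: lt_trans cx.
- by rewrite add1n ltnS IH.
- rewrite IH// add0n.
  have -> : count (fun x => c <= x) s = 0%N.
    apply/eqP; rewrite -leqn0 leqNgt -has_count.
    by apply/hasPn => y /xs yx; rewrite -ltNge; exact: lt_trans cx.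
  by [].
Qed.

Lemma ler_cos {R : realType} (x y : R) : x \in `[0, pi] -> y \in `[0, pi] ->
  (cos x <= cos y) = (y <= x).
Proof. by move=> hx hy; rewrite !leNgt ltr_cos. Qed.

Definition zeros_in_band {R : realType} (p : {poly R}) : seq R :=
  rev [seq x <- rootsR p | -2 <= x <= 2].

Lemma zeros_in_band_sorted {R : realType} (p : {poly R}) :
  sorted (fun x y => y < x) (zeros_in_band p).
Proof.
rewrite /zeros_in_band rev_sorted; apply: sorted_filter; last exact: sorted_roots.
by move=> y x z; exact: lt_trans.
Qed.

Lemma mem_zeros_in_band {R : realType} (p : {poly R}) (x : R) : p != 0 ->
  (x \in zeros_in_band p) = (-2 <= x <= 2) && root p x.
Proof.
move=> p0; rewrite /zeros_in_band mem_rev mem_filter; congr (_ && _).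
by have := roots_on_rootsR p0 => /(_ x); rewrite in_itv /= => <-.
Qed.

Lemma zeros_in_band_uniq {R : realType} (p : {poly R}) : uniq (zeros_in_band p).
Proof.
apply: sorted_uniq (zeros_in_band_sorted p); first by move=> y x z xy yz; exact: lt_trans yz xy.
by move=> x; rewrite ltxx.
Qed.

Lemma count_split_at {R : realType} (s : seq R) (c c' : R) : c' <= c ->
  count (fun x => c' <= x) s =
  (count (fun x => (c <= x)%R) s + count (fun x => (c' <= x < c)%R) s)%N.
Proof.
move=> cc; elim: s => //= x s ->.
case: (leP c x) => cx; last by rewrite andbT add0n addnCA.
by rewrite (le_trans cc cx) addnA.
Qed.

Lemma count_eq1 {T : eqType} (s : seq T) (p : pred T) x : uniq s -> x \in s -> p x ->
  (forall y, y \in s -> p y -> y = x) -> count p s = 1%N.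
Proof.
move=> us xs px h; have -> : count p s = count_mem x s.
  apply: eq_in_count => y ys /=; apply/idP/eqP => [|->//]; exact: h.
by rewrite count_uniq_mem// xs.
Qed.

(** P plays the role of q_m and Q that of V_(m-1).  The variable z is the scaled
    angle m t shifted by om, where om = pi/2 in the resonant and om = 0 in the
    nonresonant case; in both cases P behaves like sin z and Q,
    near the zeros i pi of sin z, like cos z, up to factors of the sign of s. *)
Section Counting.
Context {R : realType}.
Variables (P Q : {poly R}) (s om de : R) (m j : nat).
Hypotheses (m_gt0 : (0 < m)%N) (j_gt0 : (0 < j)%N) (om_ge0 : 0 <= om) (de_gt0 : 0 < de)
  (om_de : om <= pi - de) (de_le : de <= pi / 2)
  (small : (j%:R * pi + de - om) / m%:R <= pi).

(** The spectral parameter 2 cos t at scaled angle z = m t + om. *)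
Definition energy (z : R) : R := 2 * cos ((z - om) / m%:R).

Hypotheses
  (gap : forall i z, (i <= j)%N -> om <= z <= j%:R * pi + de ->
     (i == 0%N) || (i%:R * pi + de <= z) -> z <= i.+1%:R * pi - de ->
     0 < s * (-1) ^+ i * P.[energy z])
  (window : forall i z, (0 < i <= j)%N -> i%:R * pi - de <= z <= i%:R * pi + de ->
     0 < s * (-1) ^+ i * Q.[energy z])
  (wronskian : forall x, P^`().[x] * Q.[x] - P.[x] * Q^`().[x] != 0).

Let Z := zeros_in_band P.
Let zmax := j%:R * pi + de.

Lemma mR_gt0 : 0 < m%:R :> R. Proof. by rewrite ltr0n. Qed.

Lemma muln_pi_le i k : (i <= k)%N -> i%:R * pi <= k%:R * pi :> R.
Proof. by move=> ik; rewrite ler_wpM2r ?pi_ge0// ler_nat. Qed.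

Lemma angle_itv z : om <= z <= zmax -> (z - om) / m%:R \in `[0, pi].
Proof.
move=> /andP[h1 h2]; rewrite in_itv /= divr_ge0 ?subr_ge0//=.
by apply: le_trans small; rewrite ler_pM2r ?invr_gt0 ?mR_gt0// lerD2r.
Qed.

Lemma ler_energy z z' : om <= z <= zmax -> om <= z' <= zmax ->
  (energy z <= energy z') = (z' <= z).
Proof.
move=> h h'; rewrite /energy ler_pM2l//.
by rewrite ler_cos ?angle_itv// ler_pM2r ?invr_gt0 ?mR_gt0// lerD2r.
Qed.

Lemma energy_surj x z : om <= z <= zmax -> -2 <= x <= 2 -> energy z <= x ->
  exists2 z', om <= z' <= z & x = energy z'.
Proof.
move=> hz /andP[x2 x2'] zx.
have xi : x / 2 \in `[-1, 1].
  by rewrite in_itv /=; apply/andP; split; lra.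
have xi' : -1 <= x / 2 <= 1 by move: xi; rewrite in_itv.
have ac : acos (x / 2) \in `[0, pi] by rewrite in_itv /= acos_ge0 ?acos_lepi.
exists (om + m%:R * acos (x / 2)).
  apply/andP; split; first by rewrite lerDl mulr_ge0// acos_ge0.
  have := ler_cos (angle_itv hz) ac.
  rewrite acosK//.
  have -> : cos ((z - om) / m%:R) <= x / 2 by move: zx; rewrite /energy; lra.
  by move/esym; rewrite ler_pdivlMr ?mR_gt0// [_ * m%:R]mulrC; lra.
rewrite /energy addrAC subrr add0r mulrAC divff ?gt_eqF ?mR_gt0// mul1r acosK//.
lra.
Qed.

Lemma energy_itv z : -2 <= energy z <= 2.
Proof.
rewrite /energy; have := cos_geN1 ((z - om) / m%:R); have := cos_le1 ((z - om) / m%:R).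
by move=> ? ?; apply/andP; split; lra.
Qed.

Let gap_neq0 i z : (i <= j)%N -> om <= z <= zmax ->
  (i == 0%N) || (i%:R * pi + de <= z) -> z <= i.+1%:R * pi - de -> P.[energy z] != 0.
Proof.
move=> h1 h2 h3 h4; have := gap h1 h2 h3 h4.
by apply: contraTneq => ->; rewrite mulr0 ltxx.
Qed.

Ltac lra_params := move: (om_ge0) (om_de) (de_gt0) (de_le); lra.

Let P_neq0 : P != 0.
Proof.
have : P.[energy om] != 0.
  apply: (gap_neq0 (leq0n j)) => //; rewrite ?mul1r// lexx /zmax /=.
  by have := muln_pi_le j_gt0; rewrite mul1r; lra_params.
by apply: contraNneq => ->; rewrite horner0.
Qed.

Let count_ge z := count (fun x => energy z <= x) Z.

Lemma zero_at_angle x z : x \in Z -> om <= z <= zmax -> energy z <= x ->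
  exists2 z', om <= z' <= z & x = energy z' /\ P.[energy z'] = 0.
Proof.
rewrite mem_zeros_in_band// => /andP[x2 /eqP Px] hz zx.
by have [z' hz' e] := energy_surj hz x2 zx; exists z' => //; rewrite -e.
Qed.

Lemma count_before_first : count_ge (pi - de) = 0%N.
Proof.
apply/eqP; rewrite -leqn0 leqNgt -has_count; apply/hasPn => x xZ.
have jpi := muln_pi_le j_gt0; rewrite mul1r in jpi.
have hz : om <= pi - de <= zmax by rewrite om_de /zmax; lra_params.
apply/negP => h; have [z /andP[z1 z2] [_ Pz]] := zero_at_angle xZ hz h.
suff : P.[energy z] != 0 by rewrite Pz eqxx.
by apply: (gap_neq0 (leq0n j)); rewrite ?mul1r// z1 (le_trans z2)//; case/andP: hz.
Qed.

Lemma count_gap i : (0 < i)%N -> (i < j)%N ->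
  count_ge (i.+1%:R * pi - de) = count_ge (i%:R * pi + de).
Proof.
move=> i0 ij; have h1 := muln_pi_le ij; have h2 := muln_pi_le i0.
have hS : i.+1%:R * pi = i%:R * pi + pi :> R by rewrite -natr1; ring.
rewrite mul1r in h2.
have hz : om <= i.+1%:R * pi - de <= zmax by apply/andP; split; rewrite /zmax; lra_params.
have hz' : om <= i%:R * pi + de <= zmax by apply/andP; split; rewrite /zmax; lra_params.
have zz : i%:R * pi + de <= i.+1%:R * pi - de by lra_params.
rewrite /count_ge (@count_split_at _ _ (energy (i%:R * pi + de))) ?ler_energy//.
rewrite [X in (_ + X)%N](_ : _ = 0%N) ?addn0//.
apply/eqP; rewrite -leqn0 leqNgt -has_count; apply/hasPn => x xZ.
apply/negP => /andP[h xlt]; have [z /andP[z1 z2] [e Pz]] := zero_at_angle xZ hz h.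
have hzz : om <= z <= zmax by rewrite z1 (le_trans z2)//; case/andP: hz.
suff : P.[energy z] != 0 by rewrite Pz eqxx.
apply: (gap_neq0 (ltnW ij)) => //; apply/orP; right.
by move: xlt; rewrite e ltNge ler_energy// -ltNge => /ltW.
Qed.

Lemma sign_change_root i : (0 < i <= j)%N ->
  exists2 x, energy (i%:R * pi + de) < x < energy (i%:R * pi - de) & root P x.
Proof.
move=> /andP[i0 ij]; have h1 := muln_pi_le ij; have h2 := muln_pi_le i0.
rewrite mul1r in h2.
have hz : om <= i%:R * pi - de <= zmax by apply/andP; split; rewrite /zmax; lra_params.
have hz' : om <= i%:R * pi + de <= zmax by apply/andP; split; rewrite /zmax; lra_params.
have hS : i.+1%:R * pi = i%:R * pi + pi :> R by rewrite -natr1; ring.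
have g1 : 0 < s * (-1) ^+ i * P.[energy (i%:R * pi + de)].
  by apply: gap => //; rewrite ?lexx ?orbT//; lra_params.
have g2 : 0 < s * (-1) ^+ i.-1 * P.[energy (i%:R * pi - de)].
  apply: gap => //; first exact: leq_trans (leq_pred _) ij.
  - case: (i) i0 => // -[|k] _ //=; rewrite -[k.+2%:R]natr1 mulrDl mul1r.
    by move: de_le; have := @pi_gt0 R; lra_params.
  - by rewrite prednK.
have hlt : energy (i%:R * pi + de) <= energy (i%:R * pi - de) by rewrite ler_energy//; lra_params.
have hneg : P.[energy (i%:R * pi + de)] * P.[energy (i%:R * pi - de)] < 0.
  move: g1 g2; rewrite -(prednK i0) exprS /=.
  set A := P.[_]; set B := P.[_]; set sg := (-1) ^+ _ => g1 g2.
  have := mulr_gt0 g1 g2; have sg2 : sg * sg = 1.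
    by rewrite /sg -expr2 sqrr_sign.
  have -> : s * (-1 * sg) * A * (s * sg * B) = - ((s * s) * (A * B) * (sg * sg)) by ring.
  rewrite sg2 mulr1 oppr_gt0 => h.
  by rewrite ltNge; apply/negP => hAB; move: h; rewrite ltNge mulr_ge0// -expr2 sqr_ge0.
have [x] := poly_ivtoo hlt hneg.
by rewrite in_itv /=; exists x.
Qed.

(** At least one zero by the change of sign of P, at most one because Q does not
    vanish and the Wronskian has no zero. *)
Lemma count_window i : (0 < i <= j)%N ->
  count_ge (i%:R * pi + de) = (count_ge (i%:R * pi - de)).+1.
Proof.
move=> i0j; have [i0 ij] := andP i0j; have h1 := muln_pi_le ij; have h2 := muln_pi_le i0.
rewrite mul1r in h2.
have hz : om <= i%:R * pi - de <= zmax by apply/andP; split; rewrite /zmax; lra_params.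
have hz' : om <= i%:R * pi + de <= zmax by apply/andP; split; rewrite /zmax; lra_params.
have hlt : energy (i%:R * pi + de) <= energy (i%:R * pi - de) by rewrite ler_energy//; lra_params.
rewrite /count_ge (@count_split_at _ _ (energy (i%:R * pi - de)))//.
rewrite -addn1; congr (_ + _)%N.
have [x /andP[x1 x2] Px] := sign_change_root i0j.
have e1 := energy_itv (i%:R * pi + de); have e2 := energy_itv (i%:R * pi - de).
have xZ : x \in Z.
  rewrite mem_zeros_in_band// Px andbT.
  by move/andP: e1 => [e1 _]; move/andP: e2 => [_ e2]; apply/andP; split; lra_params.
have two u v : u \in Z -> v \in Z -> energy (i%:R * pi + de) <= u < energy (i%:R * pi - de) ->
    energy (i%:R * pi + de) <= v < energy (i%:R * pi - de) -> u < v -> False.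
  rewrite !mem_zeros_in_band// => /andP[_ /eqP Pu] /andP[_ /eqP Pv] /andP[u1 u2] /andP[v1 v2] uv.
  have [c] : exists c, P^`().[c] * Q.[c] - P.[c] * Q^`().[c] = 0.
    apply: (wronskian_common_root uv Pu Pv) => c /andP[uc cv].
    have c2 : -2 <= c <= 2.
      by move/andP: e1 => [e1 _]; move/andP: e2 => [_ e2]; apply/andP; split; lra_params.
    have ec : energy (i%:R * pi + de) <= c by exact: le_trans uc.
    have [z /andP[z1 z2] e] := energy_surj hz' c2 ec.
    have hzz : om <= z <= zmax by rewrite z1 (le_trans z2)//; case/andP: hz'.
    have : c <= energy (i%:R * pi - de) by apply: le_trans cv _; exact: ltW.
    rewrite e ler_energy// => z3.
    have := window i0j (z := z); rewrite z2 z3 => /(_ isT).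
    by apply: contraTneq => ->; rewrite mulr0 ltxx.
  by move/eqP; apply/negP; exact: wronskian.
apply: (@count_eq1 _ _ _ x) => //; first exact: zeros_in_band_uniq.
  by rewrite x2 ltW.
move=> y yZ hy; have hx : energy (i%:R * pi + de) <= x < energy (i%:R * pi - de).
  by rewrite x2 ltW.
have [xy|yx|//] := ltrgtP y x; exfalso.
  exact: two yZ xZ hy hx xy.
exact: two xZ yZ hx hy yx.
Qed.

(** Below its window the i-th zero is preceded by exactly i - 1 zeros: none up
    to the first window, one more in each window, none in each gap. *)
Lemma count_before_window i : (0 < i <= j)%N -> count_ge (i%:R * pi - de) = i.-1.
Proof.
elim: i => // i IH /andP[_ ij].
case: (posnP i) => [->|i0]; first by rewrite mul1r count_before_first.
by rewrite count_gap// count_window ?i0 1?ltnW// IH ?i0 1?ltnW// prednK.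
Qed.

Lemma nth_zero_angle :
  (j <= size Z)%N /\
  `|om + m%:R * acos (nth 0 Z j.-1 / 2) - j%:R * pi| <= de.
Proof.
have j0 := j_gt0; have j0j : (0 < j <= j)%N by rewrite j0 /=.
have c1 := count_before_window j0j; have c2 := count_window j0j.
rewrite c1 prednK// in c2.
have js : (j <= size Z)%N by rewrite -c2 /count_ge count_size.
split => //; have jl : (j.-1 < size Z)%N by rewrite prednK.
set x := nth 0 Z j.-1.
have jpi := muln_pi_le j0; rewrite mul1r in jpi.
have hz : om <= j%:R * pi - de <= zmax by apply/andP; split; rewrite /zmax; lra_params.
have hz' : om <= j%:R * pi + de <= zmax by apply/andP; split; rewrite /zmax; lra_params.
have xE1 : energy (j%:R * pi + de) <= x.
  rewrite /x count_decreasing_nth ?zeros_in_band_sorted//.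
  by rewrite -/(count_ge _) c2 prednK.
have xE2 : ~~ (energy (j%:R * pi - de) <= x).
  rewrite /x count_decreasing_nth ?zeros_in_band_sorted//.
  by rewrite -/(count_ge _) c1 ltnn.
have xZ : x \in Z by exact: mem_nth.
have [z /andP[z1 z2] [e _]] := zero_at_angle xZ hz' xE1.
have hzz : om <= z <= zmax by rewrite z1 (le_trans z2)//; case/andP: hz'.
rewrite e ler_energy// -ltNge in xE2.
rewrite e /energy mulrAC divff ?mul1r ?pnatr_eq0// cosK ?angle_itv//.
rewrite [m%:R * _]mulrC divfK ?gt_eqF ?mR_gt0// [om + _]addrC subrK.
by rewrite ler_norml; apply/andP; split; lra_params.
Qed.

End Counting.

(** * Trigonometric bounds and the free solutions *)

Section Trigonometry.
Context {R : realType}.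
Implicit Types t u x : R.

Lemma sin_le_norm u : 0 <= u -> `|sin u| <= u.
Proof.
rewrite le_eqVlt => /orP[/eqP<-|u0]; first by rewrite sin0 normr0.
have [c _] := @MVT R sin cos 0 u u0 (fun x _ => is_derive_sin x)
  (continuous_subspaceT (@continuous_sin R)).
rewrite sin0 !subr0 => ->; rewrite normrM (gtr0_norm u0).
by rewrite -[leRHS]mul1r ler_pM2r// cos_max.
Qed.

Lemma one_sub_cos t : 1 - cos t = 2 * sin (t / 2) ^+ 2.
Proof.
have -> : cos t = cos ((t / 2) *+ 2) by rewrite -mulr_natr divfK.
by rewrite cos_mulr2n sin2cos2; lra.
Qed.

Lemma one_sub_cos_le t : 0 <= t -> 1 - cos t <= t ^+ 2 / 2.
Proof.
move=> t0; rewrite one_sub_cos; have t20 : 0 <= t / 2 by lra.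
have := sin_le_norm t20; rewrite ler_norml => /andP[h1 h2].
by have : sin (t / 2) ^+ 2 <= (t / 2) ^+ 2; [rewrite -ler_sqrt ?sqr_ge0// !sqrtr_sqr (ger0_norm t20); exact: sin_le_norm|lra].
Qed.

Lemma one_sub_cos_ge0 t : 0 <= 1 - cos t.
Proof. by rewrite subr_ge0 cos_le1. Qed.

Lemma cos_ge_half x : `|x| <= 1 -> 2^-1 <= cos x.
Proof.
move=> x1; rewrite -cos_norm; have := one_sub_cos_le (normr_ge0 x).
by have : `|x| ^+ 2 <= 1; [rewrite expr_le1|lra].
Qed.

Lemma sin_ge_half u : 0 <= u <= 1 -> u / 2 <= sin u.
Proof.
rewrite le_eqVlt => /andP[/orP[/eqP<-|u0] u1]; first by rewrite sin0 mul0r.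
have [c] := @MVT R sin cos 0 u u0 (fun x _ => is_derive_sin x)
  (continuous_subspaceT (@continuous_sin R)).
rewrite in_itv /= => /andP[c0 cu]; rewrite sin0 !subr0 => ->.
have : 2^-1 <= cos c by apply: cos_ge_half; rewrite gtr0_norm//; lra.
by nra.
Qed.

Lemma sin_shift_npi x i : sin (x + i%:R * pi) = (-1) ^+ i * sin x.
Proof.
elim: i => [|i IH]; first by rewrite mul0r addr0 mul1r.
have -> : x + i.+1%:R * pi = (x + i%:R * pi) + pi by rewrite -natr1; ring.
by rewrite sinDpi IH exprS; ring.
Qed.

Lemma cos_shift_npi x i : cos (x + i%:R * pi) = (-1) ^+ i * cos x.
Proof.
elim: i => [|i IH]; first by rewrite mul0r addr0 mul1r.
have -> : x + i.+1%:R * pi = (x + i%:R * pi) + pi by rewrite -natr1; ring.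
by rewrite cosDpi IH exprS; ring.
Qed.

(** The free system for the solution cos (k t). *)
Lemma cos_second_difference t k :
  cos (k.+2%:R * t) - cos (k.+1%:R * t) =
  cos (k.+1%:R * t) - cos (k%:R * t) - (2 - 2 * cos t) * cos (k.+1%:R * t).
Proof.
have -> : k.+2%:R * t = k.+1%:R * t + t by rewrite -[k.+2%:R]natr1; ring.
have -> : k%:R * t = k.+1%:R * t - t by rewrite -natr1; ring.
by rewrite cosD cosB; ring.
Qed.

(** The free solution sin (k t) / sin t, written as a sum (as for the Dirichlet
    kernel) so that it also makes sense, with value k, at t = 0. *)
Definition dirichlet_term t k : R := cos (k%:R * t + t / 2) / cos (t / 2).
Definition dirichlet_sum t k : R := \sum_(0 <= i < k) dirichlet_term t i.

Lemma dirichlet_sumS t k : dirichlet_sum t k.+1 = dirichlet_sum t k + dirichlet_term t k.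
Proof. by rewrite /dirichlet_sum big_nat_recr. Qed.

Lemma sin_dirichlet_sum t k : cos (t / 2) != 0 ->
  sin t * dirichlet_sum t k = sin (k%:R * t).
Proof.
move=> c0; elim: k => [|k IH]; first by rewrite /dirichlet_sum big_geq// mul0r sin0 mulr0.
rewrite dirichlet_sumS mulrDr IH /dirichlet_term.
have -> : k.+1%:R * t = (k%:R * t + t / 2) + t / 2 by rewrite -natr1; field.
have e : k%:R * t = (k%:R * t + t / 2) - t / 2 by ring.
rewrite [in sin (k%:R * t)]e.
have -> : sin t = sin (t / 2 + t / 2) by congr sin; field.
by move: (k%:R * t + t / 2) => A; rewrite !sinD sinN cosN; field.
Qed.

Lemma dirichlet_term_step t k : cos (t / 2) != 0 ->
  dirichlet_term t k.+1 = dirichlet_term t k - (2 - 2 * cos t) * dirichlet_sum t k.+1.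
Proof.
move=> c0; have h := sin_dirichlet_sum k.+1 c0.
have -> : 2 - 2 * cos t = 4 * sin (t / 2) ^+ 2 by have := one_sub_cos t; lra.
have e : sin t = 2 * sin (t / 2) * cos (t / 2).
  have -> : sin t = sin (t / 2 + t / 2) by congr sin; field.
  by rewrite sinD; ring.
have -> : 4 * sin (t / 2) ^+ 2 * dirichlet_sum t k.+1 =
   2 * sin (t / 2) * sin (k.+1%:R * t) / cos (t / 2).
  by rewrite -h e; field.
rewrite /dirichlet_term.
have -> : k%:R * t + t / 2 = k.+1%:R * t - t / 2 by rewrite -natr1; field.
by rewrite cosD cosB; field.
Qed.

End Trigonometry.

(** * Discrete Gronwall comparison *)

(** The step u is 1/m for at most m steps, so that growth by 1 + C u per step stays
    bounded by e^C.  The components are w_k and m V_(k-1), up to a common scale: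
    with this weight both equations of the system have size u. *)
Section DiscreteGronwall.
Context {R : realType}.

Lemma perturbed_step (u B th ep rho gam x y x' y' : R) :
  0 < u <= 1 -> 0 <= B -> 0 <= th <= B * u -> ep <= 1 ->
  `|rho - 1| <= ep -> `|gam - 1| <= ep ->
  y' = y - th * rho * x -> x' = x + gam * u * y' ->
  `|x'| + `|y'| <= (1 + (6 * B + 2) * u) * (`|x| + `|y|) /\
  `|y'| <= (1 + 2 * B) * (`|x| + `|y|).
Proof.
move=> /andP[u0 u1] B0 /andP[th0 thB] ep1 hr hg -> ->.
have rho2 : `|rho| <= 2 by move: hr; rewrite ler_norml => /andP[? ?]; rewrite ler_norml; apply/andP; split; lra.
have gam2 : `|gam| <= 2 by move: hg; rewrite ler_norml => /andP[? ?]; rewrite ler_norml; apply/andP; split; lra.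
have hy : `|y - th * rho * x| <= `|y| + 2 * B * u * `|x|.
  apply: le_trans (ler_normB _ _) _; rewrite lerD2l !normrM ler_wpM2r//.
  by rewrite (ger0_norm th0) mulrC -mulrA ler_pM.
have hx : `|x + gam * u * (y - th * rho * x)| <= `|x| + 2 * u * (`|y| + 2 * B * u * `|x|).
  apply: le_trans (ler_normD _ _) _; rewrite lerD2l !normrM (gtr0_norm u0).
  by apply: ler_pM => //; [rewrite mulr_ge0// ltW|rewrite ler_pM2r].
have x0 := normr_ge0 x; have y0 := normr_ge0 y.
have p1 : 0 <= B * u * `|x| by rewrite !mulr_ge0// ltW.
have p2 : 0 <= B * u * `|y| by rewrite !mulr_ge0// ltW.
have p3 : 0 <= u * `|x| by rewrite mulr_ge0// ltW.
have p4 : 0 <= (1 - u) * (B * u * `|x|) by rewrite mulr_ge0// subr_ge0.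
have p5 : 0 <= (1 - u) * (B * `|x|) by rewrite !mulr_ge0// subr_ge0.
have p6 : 0 <= B * `|y| by rewrite mulr_ge0.
split; last lra.
apply: le_trans (lerD hx hy) _; lra.
Qed.

Lemma perturbed_error_step (u B th ep rho gam x y x' y' f g f' g' : R) :
  0 < u <= 1 -> 0 <= B -> 0 <= th <= B * u -> 0 <= ep <= 1 ->
  `|rho - 1| <= ep -> `|gam - 1| <= ep ->
  y' = y - th * rho * x -> x' = x + gam * u * y' ->
  g' = g - th * f -> f' = f + u * g' ->
  `|x' - f'| + `|y' - g'| <= (1 + (6 * B + 2) * u) * (`|x - f| + `|y - g|)
    + (6 * B + 2) * u * ep * (`|x| + `|y|).
Proof.
move=> hu B0 hth /andP[ep0 ep1] hr hg ey ex eg ef.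
have [_ hy'] := perturbed_step hu B0 hth ep1 hr hg ey ex.
case/andP: hu => u0 u1; case/andP: hth => th0 thB.
have h1 : `|y' - g'| <= `|y - g| + B * u * `|x - f| + B * u * (ep * `|x|).
  have -> : y' - g' = (y - g) - th * (x - f) - th * ((rho - 1) * x) by rewrite ey eg; ring.
  apply: le_trans (ler_normB _ _) _; apply: lerD.
    apply: le_trans (ler_normB _ _) _; rewrite lerD2l normrM (ger0_norm th0).
    by rewrite ler_wpM2r.
  rewrite normrM (ger0_norm th0) normrM ler_pM// ?mulr_ge0//.
  by rewrite ler_wpM2r.
have h2 : `|x' - f'| <= `|x - f| + u * `|y' - g'| + u * (ep * `|y'|).
  have -> : x' - f' = (x - f) + u * (y' - g') + u * ((gam - 1) * y') by rewrite ex ef; ring.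
  apply: le_trans (ler_normD _ _) _; apply: lerD.
    by apply: le_trans (ler_normD _ _) _; rewrite lerD2l normrM (gtr0_norm u0).
  by rewrite normrM (gtr0_norm u0) normrM ler_pM2l// ler_wpM2r.
move: hy' h1 h2; set Y := `|y'|; set H := `|y' - g'|; set E := `|x' - f'|.
have := normr_ge0 x; have := normr_ge0 y; have := normr_ge0 (x - f); have := normr_ge0 (y - g).
set e := `|x - f|; set h := `|y - g|; set p := `|x|; set q := `|y| => h0 e0 q0 p0 hY hH hE.
have u0' := ltW u0.
have k1 : u * H <= u * (h + B * u * e + B * u * (ep * p)) by rewrite ler_pM2l.
have k2 : u * (ep * Y) <= u * (ep * ((1 + 2 * B) * (p + q))) by rewrite ler_pM2l// ler_wpM2l.
have n1 : 0 <= (1 - u) * (B * u * e) by rewrite !mulr_ge0// subr_ge0.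
have n2 : 0 <= (1 - u) * (B * u * (ep * p)) by rewrite !mulr_ge0// subr_ge0.
have n3 : 0 <= B * u * e by rewrite !mulr_ge0.
have n4 : 0 <= B * u * (ep * p) by rewrite !mulr_ge0.
have n5 : 0 <= u * (ep * p) by rewrite !mulr_ge0.
have n6 : 0 <= u * (ep * q) by rewrite !mulr_ge0.
have n7 : 0 <= B * u * (ep * q) by rewrite !mulr_ge0.
have n8 : 0 <= B * u * h by rewrite !mulr_ge0.
have n9 : 0 <= u * h by rewrite !mulr_ge0.
have n10 : 0 <= u * e by rewrite !mulr_ge0.
lra.
Qed.

(** The perturbation of size ep acts over the whole range and contributes C ep
    times the initial size, while the initial error is merely amplified. *)
Lemma gronwall_comparison (u B th ep : R) (rho gam x y f g : nat -> R) :
  0 < u <= 1 -> 0 <= B -> 0 <= th <= B * u -> 0 <= ep <= 1 ->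
  (forall k, `|rho k - 1| <= ep) -> (forall k, `|gam k - 1| <= ep) ->
  (forall k, y k.+1 = y k - th * rho k * x k) ->
  (forall k, x k.+1 = x k + gam k * u * y k.+1) ->
  (forall k, g k.+1 = g k - th * f k) ->
  (forall k, f k.+1 = f k + u * g k.+1) ->
  forall k, k%:R * u <= 1 ->
  `|x k - f k| + `|y k - g k| <= expR (6 * B + 2) *
    (`|x 0%N - f 0%N| + `|y 0%N - g 0%N| + (6 * B + 2) * ep * (`|x 0%N| + `|y 0%N|)).
Proof.
move=> hu B0 hth hep hrho hgam ey ex eg ef.
have [u0 u1] := andP hu; have [ep0 ep1] := andP hep.
set C := 6 * B + 2; have C0 : 0 <= C by rewrite /C; lra.
pose Z k := `|x k| + `|y k|; pose E k := `|x k - f k| + `|y k - g k|.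
have Z0 k : 0 <= Z k by rewrite addr_ge0.
have E0 k : 0 <= E k by rewrite addr_ge0.
have L0 : 0 <= 1 + C * u by rewrite addr_ge0// mulr_ge0// ltW.
have Cu : 0 <= C * u by rewrite mulr_ge0// ltW.
have ZS k : Z k <= (1 + C * u) ^+ k * Z 0%N.
  elim: k => [|k IH]; first by rewrite mul1r.
  have [h _] := perturbed_step hu B0 hth ep1 (hrho k) (hgam k) (ey k) (ex k).
  by apply: le_trans h _; rewrite exprS -mulrA ler_wpM2l.
have ES k : E k <= (1 + C * u) ^+ k * (E 0%N + k%:R * (C * u * ep * Z 0%N)).
  elim: k => [|k IH]; first by rewrite mul0r addr0 mul1r.
  have h := perturbed_error_step hu B0 hth hep (hrho k) (hgam k) (ey k) (ex k) (eg k) (ef k).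
  apply: le_trans h _; rewrite -/C -/(Z k) -/(E k).
  have h1 : (1 + C * u) * E k <= (1 + C * u) * ((1 + C * u) ^+ k * (E 0%N + k%:R * (C * u * ep * Z 0%N))).
    by rewrite ler_wpM2l.
  have h2 : C * u * ep * Z k <= C * u * ep * ((1 + C * u) ^+ k * Z 0%N).
    by rewrite ler_wpM2l// mulr_ge0.
  apply: le_trans (lerD h1 h2) _; rewrite exprS -natr1.
  set W := (1 + C * u) ^+ k.
  have W0 : 0 <= W by rewrite exprn_ge0.
  rewrite -subr_ge0.
  have -> : (1 + C * u) * W * (E 0%N + (k%:R + 1) * (C * u * ep * Z 0%N)) -
    ((1 + C * u) * (W * (E 0%N + k%:R * (C * u * ep * Z 0%N))) + C * u * ep * (W * Z 0%N))
    = (C * u) * (C * u) * ep * W * Z 0%N by ring.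
  by rewrite !mulr_ge0// ltW.
move=> k ku; apply: le_trans (ES k) _.
apply: ler_pM => //.
- exact: exprn_ge0.
- by rewrite addr_ge0// !mulr_ge0// ltW.
- apply: (@le_trans _ _ (expR (C * u) ^+ k)).
    by rewrite lerXn2r ?nnegrE ?expR_ge0// expR_ge1Dx.
  rewrite -expRM_natl ler_expR.
  by have /(_ _ _ ku) h := ler_wpM2l C0; have := h; lra.
- rewrite lerD2l.
  have -> : k%:R * (C * u * ep * Z 0%N) = (k%:R * u) * (C * ep * Z 0%N) by ring.
  by rewrite -[leRHS]mul1r ler_wpM2r// !mulr_ge0.
Qed.

End DiscreteGronwall.

(** * The Casoratian with the edge solution *)

Section CasoratianPolynomials.
Context {R : realType}.
Variables (a b psi : nat -> R).
Hypotheses (a_gt0 : forall n, 0 < a n)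
  (psiE : forall n, a n.+1 * psi n.+2 + (b n.+1 - 2) * psi n.+1 + a n * psi n = 0).

(** The indices are those of the Jost recursion, of which q_n = p_(n-1) is the
    solution with q_0 = 0 and q_1 = 1. *)
Definition shifted_poly n : {poly R} := if n is k.+1 then orthopoly a b k else 0.
Local Notation q := shifted_poly.

Lemma shifted_polyE n :
  a n.+1 *: q n.+2 = ('X - (b n.+1)%:P) * q n.+1 - a n *: q n.
Proof.
rewrite /shifted_poly -/shifted_poly.
rewrite [orthopoly a b n.+1]/= scalerA divff ?gt_eqF// scale1r.
by case: n.
Qed.

Definition casoratian n : {poly R} := a n *: (psi n *: q n.+1 - psi n.+1 *: q n).

(** The recursions of psi and q have the same coefficients and differ only in their
    spectral parameters, 2 and X. *)
Lemma casoratianS n :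
  casoratian n.+1 = casoratian n - (2%:P - 'X) * (psi n.+1 *: q n.+1).
Proof.
rewrite /casoratian !scalerBr.
have -> : a n.+1 *: (psi n.+1 *: q n.+2) = psi n.+1 *: (a n.+1 *: q n.+2).
  by rewrite scalerA mulrC -scalerA.
rewrite shifted_polyE (scalerA (a n.+1)).
have -> : a n.+1 * psi n.+2 = 2 * psi n.+1 - b n.+1 * psi n.+1 - a n * psi n.
  by have := psiE n; lra.
rewrite -!mul_polyC !rmorphB !rmorphM /=.
by ring.
Qed.

Lemma horner_casoratianS n x :
  (casoratian n.+1).[x] = (casoratian n).[x] - (2 - x) * (psi n.+1 * (q n.+1).[x]).
Proof.
rewrite casoratianS; move: (casoratian n) (q n.+1) => A B.
by rewrite !(hornerD, hornerN, hornerM, hornerZ, hornerX, hornerC).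
Qed.

Lemma casoratian0 : a 0%N = 1 -> casoratian 0 = (psi 0%N)%:P.
Proof.
move=> a0; rewrite /casoratian a0 scale1r /shifted_poly /= scaler0 subr0.
by rewrite -mul_polyC mulr1.
Qed.

(** Equals the sum of the squares q_1^2 + ... + q_n^2, by the next lemma. *)
Definition christoffel_darboux n : {poly R} :=
  a n *: ((q n.+1)^`() * q n - q n.+1 * (q n)^`()).

Lemma christoffel_darbouxS n :
  christoffel_darboux n.+1 = christoffel_darboux n + q n.+1 ^+ 2.
Proof.
rewrite /christoffel_darboux scalerBr.
have -> : a n.+1 *: ((q n.+2)^`() * q n.+1) = (a n.+1 *: q n.+2)^`() * q n.+1.
  by rewrite [in RHS]derivZ -scalerAl.
have -> : a n.+1 *: (q n.+2 * (q n.+1)^`()) = (a n.+1 *: q n.+2) * (q n.+1)^`().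
  exact: scalerAl.
rewrite shifted_polyE derivB derivM derivB derivX derivC derivZ -!mul_polyC.
by ring.
Qed.

Lemma christoffel_darboux_gt0 n x : 0 < (christoffel_darboux n.+1).[x].
Proof.
elim: n => [|n IH].
  have e0 : christoffel_darboux 0 = 0.
    by rewrite /christoffel_darboux /= deriv0 !mulr0 subrr scaler0.
  by rewrite christoffel_darbouxS e0 add0r expr1n hornerC ltr01.
rewrite christoffel_darbouxS hornerD horner_exp; apply: ltr_wpDr => //.
exact: sqr_ge0.
Qed.

(** The part of the Casoratian that is a multiple of the polynomial itself drops
    out of the Wronskian; the other part gives, up to a nonzero factor, the
    Christoffel-Darboux sum, which is positive. *)
Lemma wronskian_casoratian n x : psi n.+2 != 0 ->
  (q n.+2)^`().[x] * (casoratian n.+1).[x] - (q n.+2).[x] * (casoratian n.+1)^`().[x] != 0.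
Proof.
move=> p0.
have -> : (q n.+2)^`().[x] * (casoratian n.+1).[x] - (q n.+2).[x] * (casoratian n.+1)^`().[x]
   = - psi n.+2 * (christoffel_darboux n.+1).[x].
  rewrite /casoratian /christoffel_darboux; move: (q n.+2) (q n.+1) => A B.
  by rewrite derivZ derivB !derivZ !(hornerZ, hornerD, hornerN, hornerM); ring.
by rewrite mulf_neq0// ?oppr_eq0// gt_eqF// christoffel_darboux_gt0.
Qed.

(** Reduction of order by the solution psi. *)
Lemma shifted_poly_psi n x : psi n != 0 -> psi n.+1 != 0 ->
  (q n.+1).[x] / psi n.+1 = (q n).[x] / psi n
    + (a n * psi n * psi n.+1)^-1 * (casoratian n).[x].
Proof.
move=> p0 p1; have a0 : a n != 0 by rewrite gt_eqF.
by rewrite /casoratian; move: (q n.+1) (q n) => A B; rewrite !(hornerZ, hornerD, hornerN); field; rewrite p0 p1 a0.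
Qed.

Lemma horner_bounded_band (p : {poly R}) :
  exists2 M, 0 <= M & forall x, `|x| <= 2 -> `|p.[x]| <= M.
Proof.
elim/poly_ind: p => [|p c [M M0 hM]]; first by exists 0 => // x _; rewrite horner0 normr0.
exists (M * 2 + `|c|) => [|x x2]; first by rewrite addr_ge0// mulr_ge0.
rewrite hornerMXaddC; apply: le_trans (ler_normD _ _) _; rewrite lerD2r normrM.
by apply: ler_pM => //; exact: hM.
Qed.

(** The rate t^2 is what makes initial data at a fixed index negligible after
    multiplication by m when t = O(1/m). *)
Lemma horner_near_edge (p : {poly R}) :
  exists2 M, 0 <= M & forall t, 0 <= t -> `|p.[2 * cos t] - p.[2]| <= M * t ^+ 2.
Proof.
have : root (p - p.[2]%:P) 2 by rewrite /root !hornerE subrr.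
move=> /factor_theorem [r er].
have [M M0 hM] := horner_bounded_band r; exists M => // t t0.
have -> : p.[2 * cos t] - p.[2] = r.[2 * cos t] * (2 * cos t - 2).
  by have := congr1 (fun s => s.[2 * cos t]) er; rewrite !hornerE.
rewrite normrM; apply: ler_pM => //.
  by apply: hM; rewrite normrM (ger0_norm (ler0n _ 2)) ler_piMr// cos_max.
have h1 := one_sub_cos_le t0; have h2 := one_sub_cos_ge0 t.
by rewrite distrC ger0_norm; lra.
Qed.

End CasoratianPolynomials.

(** * Comparison with the free system at scale 1/m *)

Section ScalingLimit.
Context {R : realType}.
Variables (a b psi : nat -> R).
Hypotheses (a_gt0 : forall n, 0 < a n) (a0 : a 0%N = 1) (a_cvg1 : a @ \oo --> (1 : R))
  (psiE : forall n, a n.+1 * psi n.+2 + (b n.+1 - 2) * psi n.+1 + a n * psi n = 0)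
  (psi_cvg1 : psi @ \oo --> (1 : R)).

Local Notation q := (shifted_poly a b).
Local Notation V := (casoratian a b psi).

Lemma nat_ge_eventually (x : R) : exists m0, forall m, (m0 <= m)%N -> x <= m%:R.
Proof.
exists (Num.bound `|x|) => m hm; apply: le_trans (ler_norm x) _.
by apply/ltW/(lt_le_trans (archi_boundP (normr_ge0 x))); rewrite ler_nat.
Qed.

Lemma coefficients_near1 (ep : R) : 0 < ep -> exists N, forall n, (N <= n)%N ->
  [/\ 0 < psi n, `|psi n ^+ 2 - 1| <= ep & `|(a n * psi n * psi n.+1)^-1 - 1| <= ep].
Proof.
move=> ep0; have psiS : (fun n => psi n.+1) @ \oo --> (1 : R).
  by move: psi_cvg1; rewrite -cvg_shiftS.
have c1 : (fun n => psi n ^+ 2) @ \oo --> (1 : R).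
  have -> : (fun n => psi n ^+ 2) = (fun n => psi n * psi n) by apply/funext.
  have := @cvgM R nat eventually _ psi psi 1 1 psi_cvg1 psi_cvg1; rewrite mulr1; exact.
have c2 : (fun n => (a n * psi n * psi n.+1)^-1) @ \oo --> (1 : R).
  have := cvgV _ (cvgM (cvgM a_cvg1 psi_cvg1) psiS).
  by rewrite !mulr1 invr1; apply; exact: oner_neq0.
move/cvgrPdist_le : c1 => /(_ _ ep0) [N1 _ h1].
move/cvgrPdist_le : c2 => /(_ _ ep0) [N2 _ h2].
have [N3 _ h3] : \forall n \near \oo, 2^-1 < psi n.
  by apply: (cvgr_gt (1 : R)) => //; lra.
exists (maxn N1 (maxn N2 N3)) => n; rewrite !geq_max => /andP[/h1 /= k1 /andP[/h2 /= k2 /h3 /= k3]].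
by split; [lra|rewrite distrC|rewrite distrC].
Qed.

(** First an index n is fixed beyond which the coefficients are within ep of 1;
    then m is taken so large that the initial error K / m at n is small.  It is
    essential that Zf, the size of the initial data, does not depend on n, since n
    is chosen after ep.  The scale sg is 1 in the resonant case and m in the
    nonresonant one. *)
Lemma scaling_comparison (sg : nat -> R) (F G : nat -> R -> nat -> R) (Y Zf : R) (N0 : nat) :
  0 < Y -> 0 <= Zf ->
  (forall m t k, Y <= m%:R -> 0 <= t -> m%:R * t <= Y ->
    G m t k.+1 = G m t k - m%:R * (2 - 2 * cos t) * F m t k.+1 /\
    F m t k.+2 = F m t k.+1 + m%:R^-1 * G m t k.+1) ->
  (forall n, (N0 <= n)%N -> exists K, 0 <= K /\
    forall m t, (0 < m)%N -> Y <= m%:R -> 0 <= t -> m%:R * t <= Y ->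
    `|(q n.+1).[2 * cos t] / psi n.+1 / sg m - F m t n.+1|
    + `|m%:R * (V n).[2 * cos t] / sg m - G m t n| <= K / m%:R /\
    `|(q n.+1).[2 * cos t] / psi n.+1 / sg m| + `|m%:R * (V n).[2 * cos t] / sg m| <= Zf + K / m%:R) ->
  forall eta, 0 < eta -> exists m0, forall m t, (m0 <= m)%N -> 0 <= t -> m.+1%:R * t <= Y ->
    `|(q m.+1).[2 * cos t] / psi m.+1 / sg m.+1 - F m.+1 t m.+1|
    + `|m.+1%:R * (V m).[2 * cos t] / sg m.+1 - G m.+1 t m| <= eta.
Proof.
move=> Y0 Zf0 hFG hinit eta eta0.
set C : R := 6 * Y ^+ 2 + 2; have C0 : 0 < C by rewrite /C; have := sqr_ge0 Y; lra.
set e : R := expR C; have e0 : 0 < e by rewrite expR_gt0.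
set D : R := 2 * e * C * (Zf + 1); have D0 : 0 < D by rewrite !mulr_gt0//; lra.
(* This gives ep <= 1 and e * C * ep * (Zf + 1) <= eta / 2. *)
pose ep : R := eta / (D + eta).
have Deta : 0 < D + eta by rewrite addr_gt0.
have ep0 : 0 < ep by rewrite divr_gt0.
have ep1 : ep <= 1 by rewrite ler_pdivrMr// mul1r lerDr ltW.
have epD : D * ep <= eta.
  by rewrite /ep mulrA ler_pdivrMr// mulrC ler_pM2l// lerDl ltW.
have [N1 hN1] := coefficients_near1 ep0.
have [n nN0 hcoef] : exists2 n, (N0 <= n)%N & forall k,
    [/\ 0 < psi (n + k)%N, `|psi (n + k)%N ^+ 2 - 1| <= ep &
     `|(a (n + k)%N * psi (n + k)%N * psi (n + k).+1)^-1 - 1| <= ep].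
  exists (maxn N0 N1) => [|k]; first by rewrite leq_maxl.
  by apply: hN1; apply: leq_trans (leq_addr _ _); rewrite leq_maxr.
have [K [K0 hK]] := hinit n nN0.
have [m1 hm1] := nat_ge_eventually Y.
(* Beyond m2 both K / m <= 1 and e * K / m <= eta / 2. *)
have [m2 hm2] := nat_ge_eventually (K * (1 + 2 * e / eta)).
exists (maxn m1 (maxn m2 n)) => m t; rewrite !geq_max => /andP[/leqW m1m /andP[/leqW m2m nm]] t0 mtY.
set M := m.+1; have M0 : 0 < M%:R :> R by rewrite ltr0n.
have YM : Y <= M%:R by exact: hm1.
have [hE hZ] := hK M t isT YM t0 mtY.
set u : R := M%:R^-1.
have u0 : 0 < u by rewrite invr_gt0.
have u1 : u <= 1 by rewrite invf_le1// ler1n.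
have hKM := hm2 _ m2m.
have e2 : 0 < 2 * e / eta by rewrite divr_gt0// mulr_gt0.
have KM1 : K / M%:R <= 1.
  by rewrite ler_pdivrMr// mul1r; apply: le_trans hKM; rewrite ler_peMr//; lra.
have KM2 : e * (K / M%:R) <= eta / 2.
  rewrite mulrA ler_pdivrMr//.
  have h : K * (2 * e / eta) <= M%:R by apply: le_trans hKM; rewrite ler_wpM2l//; lra.
  have : eta * (K * (2 * e / eta)) <= eta * M%:R by rewrite ler_pM2l.
  have -> : eta * (K * (2 * e / eta)) = 2 * (e * K) by field; rewrite gt_eqF.
  lra.
set E := 2 * cos t in hE hZ *.
pose x k := (q (n + k).+1).[E] / psi (n + k).+1 / sg M.
pose y k := M%:R * (V (n + k)%N).[E] / sg M.
pose f k := F M t (n + k).+1.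
pose g k := G M t (n + k)%N.
pose th := M%:R * (2 - 2 * cos t).
have hth : 0 <= th <= Y ^+ 2 * u.
  have h1 := one_sub_cos_ge0 t; have h2 := one_sub_cos_le t0.
  apply/andP; split; first by rewrite /th mulr_ge0// ?ltW//; lra.
  rewrite /u ler_pdivlMr//.
  have -> : th * M%:R = M%:R ^+ 2 * (2 - 2 * cos t) by rewrite /th; ring.
  apply: (@le_trans _ _ (M%:R ^+ 2 * t ^+ 2)).
    by rewrite ler_wpM2l ?sqr_ge0//; lra.
  by rewrite -exprMn lerXn2r ?nnegrE ?mulr_ge0// ltW.
have hrho k : `|psi (n + k).+1 ^+ 2 - 1| <= ep by rewrite -addnS; have [] := hcoef k.+1.
have hgam k : `|(a (n + k).+1 * psi (n + k).+1 * psi (n + k).+2)^-1 - 1| <= ep.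
  by rewrite -addnS; have [] := hcoef k.+1.
have hy k : y k.+1 = y k - th * psi (n + k).+1 ^+ 2 * x k.
  have [p1 _ _] := hcoef k.+1; rewrite addnS in p1.
  rewrite /y addnS horner_casoratianS// /x /th -/E.
  move: ((sg M)^-1) => s; move: ((q _).[E]) => A; move: ((V _).[E]) => B.
  by field; rewrite gt_eqF.
have hx k : x k.+1 = x k + (a (n + k).+1 * psi (n + k).+1 * psi (n + k).+2)^-1 * u * y k.+1.
  have [p1 _ _] := hcoef k.+1; rewrite addnS in p1.
  have [p2 _ _] := hcoef k.+2; rewrite !addnS in p2.
  rewrite /x /y addnS shifted_poly_psi ?gt_eqF//.
  rewrite /u.
  move: ((a _ * _ * _)^-1) => c1; move: ((sg M)^-1) => s; move: ((psi _)^-1) => p.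
  move: ((q _).[E]) => A; move: ((V _).[E]) => B.
  by field; rewrite gt_eqF.
have hg k : g k.+1 = g k - th * f k.
  by rewrite /g /f /th addnS; have [] := hFG M t (n + k)%N YM t0 mtY.
have hf k : f k.+1 = f k + u * g k.+1.
  by rewrite /g /f /u addnS; have [_ ->] := hFG M t (n + k)%N YM t0 mtY.
have hk : (m - n)%:R * u <= 1.
  by rewrite /u ler_pdivrMr// mul1r ler_nat (leq_trans (leq_subr _ _)).
have u01 : 0 < u <= 1 by rewrite u0.
have ep01 : 0 <= ep <= 1 by rewrite ltW.
have := gronwall_comparison u01 (sqr_ge0 Y) hth ep01 hrho hgam hy hx hg hf hk.
rewrite /x /y /f /g /= subnKC// !addn0 => h; apply: le_trans h _.
rewrite -/C -/e.
apply: (@le_trans _ _ (e * (K / M%:R + C * ep * (Zf + 1)))).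
  rewrite ler_pM2l//; apply: lerD => //; rewrite ler_wpM2l//.
    by rewrite mulr_ge0// ltW.
  by apply: le_trans hZ _; rewrite lerD2l.
have : D * ep = 2 * (e * (C * ep * (Zf + 1))) by rewrite /D; ring.
by rewrite mulrDr; lra.
Qed.

End ScalingLimit.

(** * The two scaling limits *)

Section ScalingLimits.
Context {R : realType}.
Variables (a b psi : nat -> R).
Hypotheses (a_gt0 : forall n, 0 < a n) (a0 : a 0%N = 1) (a_cvg1 : a @ \oo --> (1 : R))
  (psiE : forall n, a n.+1 * psi n.+2 + (b n.+1 - 2) * psi n.+1 + a n * psi n = 0)
  (psi_cvg1 : psi @ \oo --> (1 : R)).

Local Notation q := (shifted_poly a b).
Local Notation V := (casoratian a b psi).

Lemma casoratian_at_2 n : (V n).[2] = psi 0%N.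
Proof.
elim: n => [|n IH]; first by rewrite casoratian0// hornerC.
by rewrite horner_casoratianS// IH subrr mul0r subr0.
Qed.

(** When psi_0 = 0, psi and q satisfy the same recursion with proportional
    initial data. *)
Lemma resonant_eigenvector n : psi 0%N = 0 -> psi n = psi 1%N * (q n).[2].
Proof.
move=> p0; suff h : psi n = psi 1%N * (q n).[2] /\ psi n.+1 = psi 1%N * (q n.+1).[2].
  by case: h.
elim: n => [|n [h1 h2]]; first by rewrite p0 horner0 mulr0 hornerC mulr1.
split => //; apply: (@mulfI _ (a n.+1)); first by rewrite gt_eqF.
have -> : a n.+1 * psi n.+2 = (2 - b n.+1) * psi n.+1 - a n * psi n by have := psiE n; lra.
have := congr1 (fun p : {poly R} => p.[2]) (shifted_polyE b a_gt0 n).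
move: h1 h2; move: (q n) (q n.+1) (q n.+2) => A B D h1 h2.
rewrite !(hornerD, hornerN, hornerM, hornerZ, hornerX, hornerC) => e.
rewrite mulrCA e h1 h2; ring.
Qed.

Lemma cos_sub1_le (x y : R) : 0 <= x <= y -> `|1 - cos x| <= y ^+ 2 / 2.
Proof.
move=> /andP[x0 xy]; rewrite ger0_norm ?one_sub_cos_ge0//.
apply: le_trans (one_sub_cos_le x0) _; rewrite ler_pM2r ?invr_gt0//.
by rewrite lerXn2r// nnegrE (le_trans x0).
Qed.

(** Here w_n = q_n / psi_n is constant at E = 2, with value 1 / psi_1, and V_n
    vanishes there; the free solution with these data is a multiple of
    cos (k t). *)
Lemma resonant_scaling : psi 0%N = 0 -> exists2 ka : R, ka != 0 &
  forall Y eta, 0 < Y -> 0 < eta -> exists m0, forall m t, (m0 <= m)%N -> 0 <= t ->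
  m.+1%:R * t <= Y ->
  `|(q m.+1).[2 * cos t] / psi m.+1 - ka * cos (m.+1%:R * t)|
  + `|m.+1%:R * (V m).[2 * cos t]
      - m.+1%:R * (ka * (cos (m.+1%:R * t) - cos (m%:R * t)))| <= eta.
Proof.
move=> p0.
have [N0 hN0] := coefficients_near1 a_cvg1 psi_cvg1 (@ltr01 R).
have p1 : psi 1%N != 0.
  have [h _ _] := hN0 N0 (leqnn _); move: h; rewrite resonant_eigenvector//.
  by apply: contraTneq => ->; rewrite mul0r ltxx.
exists (psi 1%N)^-1; first by rewrite invr_neq0.
move=> Y eta Y0 eta0; set ka := (psi 1%N)^-1.
pose F (m : nat) (t : R) (k : nat) : R := ka * cos (k%:R * t).
pose G (m : nat) (t : R) (k : nat) : R := m%:R * (ka * (cos (k.+1%:R * t) - cos (k%:R * t))).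
have hFG m t k : Y <= m%:R -> 0 <= t -> m%:R * t <= Y ->
    G m t k.+1 = G m t k - m%:R * (2 - 2 * cos t) * F m t k.+1 /\
    F m t k.+2 = F m t k.+1 + m%:R^-1 * G m t k.+1.
  move=> Ym _ _; have m0 : (0 : R) < m%:R by exact: lt_le_trans Ym.
  rewrite /G /F; split; first by rewrite cos_second_difference; ring.
  by field; rewrite gt_eqF.
have hinit n : (N0 <= n)%N -> exists K, 0 <= K /\
    forall m t, (0 < m)%N -> Y <= m%:R -> 0 <= t -> m%:R * t <= Y ->
    `|(q n.+1).[2 * cos t] / psi n.+1 / 1 - F m t n.+1|
    + `|m%:R * (V n).[2 * cos t] / 1 - G m t n| <= K / m%:R /\
    `|(q n.+1).[2 * cos t] / psi n.+1 / 1| + `|m%:R * (V n).[2 * cos t] / 1| <= `|ka| + K / m%:R.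
  move=> /leqW /hN0 [pn _ _].
  have [M1 M10 hM1] := horner_near_edge (q n.+1).
  have [M2 M20 hM2] := horner_near_edge (V n).
  pose L := M1 / psi n.+1 + M2 + 2 * (`|ka| * n.+1%:R ^+ 2).
  have L0 : 0 <= L by rewrite /L !addr_ge0// ?mulr_ge0// ?invr_ge0 ?sqr_ge0// ltW.
  exists (L * Y ^+ 2); split; first by rewrite mulr_ge0// sqr_ge0.
  move=> m t m0 Ym t0 mtY; rewrite !divr1.
  have mp : (0 : R) < m%:R by rewrite ltr0n.
  set A := m%:R * t ^+ 2.
  have hA : L * A <= L * Y ^+ 2 / m%:R.
    rewrite -mulrA ler_wpM2l// ler_pdivlMr// /A.
    have -> : m%:R * t ^+ 2 * m%:R = (m%:R * t) ^+ 2 by ring.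
    by rewrite lerXn2r// nnegrE ?mulr_ge0// ltW.
  have tA : t ^+ 2 <= A by rewrite /A ler_peMl ?sqr_ge0// ler1n.
  have A0 : 0 <= A by rewrite mulr_ge0// sqr_ge0.
  have q2 : (q n.+1).[2] / psi n.+1 = ka.
    have pe := resonant_eigenvector n.+1 p0.
    have : psi 1%N * (q n.+1).[2] != 0 by rewrite -pe gt_eqF.
    rewrite mulf_eq0 negb_or => /andP[_ qn0].
    by rewrite pe /ka; field; rewrite p1 qn0.
  have hx : `|(q n.+1).[2 * cos t] / psi n.+1 - ka| <= M1 / psi n.+1 * A.
    rewrite -q2 -mulrBl normrM normfV (gtr0_norm pn) mulrAC ler_pM2r ?invr_gt0//.
    by apply: le_trans (hM1 t t0) _; rewrite ler_wpM2l.
  have hy : `|m%:R * (V n).[2 * cos t]| <= M2 * A.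
    have := hM2 t t0; rewrite casoratian_at_2 p0 subr0 => h.
    by rewrite normrM normr_nat /A mulrCA ler_pM2l.
  have hc1 : `|1 - cos (n.+1%:R * t)| <= n.+1%:R ^+ 2 * t ^+ 2 / 2.
    by rewrite -exprMn; apply: cos_sub1_le; rewrite lexx mulr_ge0.
  have hc0 : `|1 - cos (n%:R * t)| <= n.+1%:R ^+ 2 * t ^+ 2 / 2.
    by rewrite -exprMn; apply: cos_sub1_le; rewrite mulr_ge0//= ler_wpM2r// ler_nat.
  have hf : `|ka - F m t n.+1| <= `|ka| * n.+1%:R ^+ 2 * A.
    have -> : ka - F m t n.+1 = ka * (1 - cos (n.+1%:R * t)) by rewrite /F; ring.
    rewrite normrM -mulrA ler_wpM2l//; apply: le_trans hc1 _.
    have : n.+1%:R ^+ 2 * t ^+ 2 <= n.+1%:R ^+ 2 * A by rewrite ler_wpM2l ?sqr_ge0.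
    have : 0 <= n.+1%:R ^+ 2 * t ^+ 2 :> R by rewrite mulr_ge0 ?sqr_ge0.
    lra.
  have hg : `|G m t n| <= `|ka| * n.+1%:R ^+ 2 * A.
    rewrite /G normrM normrM normr_nat.
    have -> : cos (n.+1%:R * t) - cos (n%:R * t) = (1 - cos (n%:R * t)) - (1 - cos (n.+1%:R * t)) by ring.
    have -> : `|ka| * n.+1%:R ^+ 2 * A = m%:R * (`|ka| * (n.+1%:R ^+ 2 * t ^+ 2)) by rewrite /A; ring.
    rewrite ler_pM2l// ler_wpM2l//; apply: le_trans (ler_normB _ _) _; lra.
  split.
    apply: le_trans hA.
    have : `|(q n.+1).[2 * cos t] / psi n.+1 - F m t n.+1| <= M1 / psi n.+1 * A + `|ka| * n.+1%:R ^+ 2 * A.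
      by rewrite -(subrKA ka); apply: le_trans (ler_normD _ _) _; exact: lerD.
    have : `|m%:R * (V n).[2 * cos t] - G m t n| <= M2 * A + `|ka| * n.+1%:R ^+ 2 * A.
      by apply: le_trans (ler_normB _ _) _; exact: lerD.
    by rewrite /L; lra.
  have : `|(q n.+1).[2 * cos t] / psi n.+1| <= `|ka| + M1 / psi n.+1 * A.
    rewrite -[X in `|X|](subrK ka) addrC; apply: le_trans (ler_normD _ _) _.
    by rewrite lerD2l.
  have : 0 <= `|ka| * n.+1%:R ^+ 2 * A by rewrite !mulr_ge0// sqr_ge0.
  by move: hA; rewrite /L; lra.
have [m0 h] := @scaling_comparison R a b psi a_gt0 a_cvg1 psiE psi_cvg1 (fun=> 1)
   F G Y `|ka| N0 Y0 (normr_ge0 _) hFG hinit eta eta0.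
by exists m0 => m t mm t0 mt; have := h m t mm t0 mt; rewrite !divr1.
Qed.

Lemma dirichlet_term_bounds (t : R) k : 0 <= t <= 1 ->
  `|dirichlet_term t k| <= 2 /\ `|1 - dirichlet_term t k| <= 2 * (k.+1%:R ^+ 2 * t ^+ 2).
Proof.
move=> /andP[t0 t1].
have c2 : 2^-1 <= cos (t / 2) by apply: cos_ge_half; rewrite ger0_norm; lra.
have c0 : 0 < cos (t / 2) by apply: lt_le_trans c2.
have ci : (cos (t / 2))^-1 <= 2 by rewrite invf_ple ?posrE.
have ci0 : 0 < (cos (t / 2))^-1 by rewrite invr_gt0.
split.
  rewrite /dirichlet_term normrM (gtr0_norm ci0) -[leRHS]mul1r.
  by apply: ler_pM => //; [exact: ltW|exact: cos_max].
have -> : 1 - dirichlet_term t k = ((1 - cos (k%:R * t + t / 2)) - (1 - cos (t / 2))) / cos (t / 2).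
  by rewrite /dirichlet_term; field; rewrite gt_eqF.
rewrite normrM (gtr0_norm ci0) mulrC.
have kt : 0 <= k%:R * t by rewrite mulr_ge0.
have h1 : `|1 - cos (k%:R * t + t / 2)| <= (k.+1%:R * t) ^+ 2 / 2.
  by apply: cos_sub1_le; rewrite -[k.+1%:R]natr1; apply/andP; split; lra.
have h2 : `|1 - cos (t / 2)| <= (k.+1%:R * t) ^+ 2 / 2.
  by apply: cos_sub1_le; rewrite -[k.+1%:R]natr1; apply/andP; split; lra.
apply: ler_pM => //; first exact: ltW.
by apply: le_trans (ler_normB _ _) _; rewrite -exprMn; lra.
Qed.

Lemma dirichlet_sum_bound (t : R) k : 0 <= t <= 1 -> `|dirichlet_sum t k| <= 2 * k%:R.
Proof.
move=> ht; elim: k => [|k IH]; first by rewrite /dirichlet_sum big_geq// normr0 mulr0.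
rewrite dirichlet_sumS; apply: le_trans (ler_normD _ _) _.
by have [h _] := dirichlet_term_bounds k ht; rewrite -natr1; lra.
Qed.

(** After division by m the value w_n / m at a fixed n is negligible and only
    V_n, close to psi_0, is left as initial datum; the free solution is a multiple
    of sin (k t) / sin t. *)
Lemma nonresonant_scaling Y eta : 0 < Y -> 0 < eta ->
  exists m0, forall m t, (m0 <= m)%N -> 0 <= t -> m.+1%:R * t <= Y ->
  `|(q m.+1).[2 * cos t] / psi m.+1 / m.+1%:R - psi 0%N * (dirichlet_sum t m.+1 / m.+1%:R)|
  + `|(V m).[2 * cos t] - psi 0%N * dirichlet_term t m| <= eta.
Proof.
move=> Y0 eta0; set ka := psi 0%N.
have [N0 hN0] := coefficients_near1 a_cvg1 psi_cvg1 (@ltr01 R).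
pose F (m : nat) (t : R) (k : nat) : R := ka * (dirichlet_sum t k / m%:R).
pose G (m : nat) (t : R) (k : nat) : R := ka * dirichlet_term t k.
have tle1 m t : Y <= m%:R -> 0 <= t -> m%:R * t <= Y -> 0 <= t <= 1.
  move=> Ym t0 mt; rewrite t0/=; have m0 : (0 : R) < m%:R by exact: lt_le_trans Ym.
  by rewrite -(ler_pM2l m0) mulr1; exact: le_trans mt Ym.
have hFG m t k : Y <= m%:R -> 0 <= t -> m%:R * t <= Y ->
    G m t k.+1 = G m t k - m%:R * (2 - 2 * cos t) * F m t k.+1 /\
    F m t k.+2 = F m t k.+1 + m%:R^-1 * G m t k.+1.
  move=> Ym t0 mt; have m0 : (0 : R) < m%:R by exact: lt_le_trans Ym.
  have /andP[_ t1] := tle1 m t Ym t0 mt.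
  have c0 : cos (t / 2) != 0.
    have : 2^-1 <= cos (t / 2) by apply: cos_ge_half; rewrite ger0_norm; lra.
    by move=> h; rewrite gt_eqF//; apply: lt_le_trans h.
  rewrite /G /F dirichlet_term_step// [dirichlet_sum t k.+2]dirichlet_sumS.
  rewrite [dirichlet_term t k.+1]dirichlet_term_step//.
  by split; field; rewrite gt_eqF.
have hinit n : (N0 <= n)%N -> exists K, 0 <= K /\
    forall m t, (0 < m)%N -> Y <= m%:R -> 0 <= t -> m%:R * t <= Y ->
    `|(q n.+1).[2 * cos t] / psi n.+1 / m%:R - F m t n.+1|
    + `|m%:R * (V n).[2 * cos t] / m%:R - G m t n| <= K / m%:R /\
    `|(q n.+1).[2 * cos t] / psi n.+1 / m%:R| + `|m%:R * (V n).[2 * cos t] / m%:R| <= `|ka| + K / m%:R.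
  move=> /leqW /hN0 [pn _ _].
  have [M1 M10 hM1] := horner_near_edge (q n.+1).
  have [M2 M20 hM2] := horner_near_edge (V n).
  pose K1 := (`|(q n.+1).[2]| + M1) / psi n.+1.
  pose K2 := `|ka| * (2 * n.+1%:R).
  pose K3 := `|ka| * (2 * n.+1%:R ^+ 2).
  have K10 : 0 <= K1 by rewrite /K1 divr_ge0 ?addr_ge0// ltW.
  have K20 : 0 <= K2 by rewrite /K2 !mulr_ge0.
  have K30 : 0 <= K3 by rewrite /K3 !mulr_ge0// sqr_ge0.
  exists (K1 + K2 + (M2 + K3) * Y ^+ 2); split.
    by rewrite !addr_ge0// mulr_ge0 ?addr_ge0// sqr_ge0.
  move=> m t m0 Ym t0 mtY.
  have mp : (0 : R) < m%:R by rewrite ltr0n.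
  have ht := tle1 m t Ym t0 mtY; have /andP[_ t1] := ht.
  rewrite [m%:R * _]mulrC mulfK ?gt_eqF//.
  set u : R := m%:R^-1; have u0 : 0 < u by rewrite invr_gt0.
  have t2 : t ^+ 2 <= Y ^+ 2 * u.
    rewrite /u ler_pdivlMr//; apply: (@le_trans _ _ (t ^+ 2 * (m%:R * m%:R))).
      by rewrite ler_wpM2l ?sqr_ge0// ler_peMl// ler1n.
    have -> : t ^+ 2 * (m%:R * m%:R) = (m%:R * t) ^+ 2 by ring.
    by rewrite lerXn2r// nnegrE ?mulr_ge0// ltW.
  have t21 : t ^+ 2 <= 1 by rewrite expr_le1.
  have hx : `|(q n.+1).[2 * cos t] / psi n.+1| <= K1.
    rewrite /K1 normrM normfV (gtr0_norm pn) ler_pM2r ?invr_gt0//.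
    rewrite -[X in `|X|](subrK (q n.+1).[2]) addrC; apply: le_trans (ler_normD _ _) _.
    by rewrite lerD2l; apply: le_trans (hM1 t t0) _; rewrite ler_piMr.
  have hy : `|(V n).[2 * cos t] - ka| <= M2 * Y ^+ 2 * u.
    have := hM2 t t0; rewrite casoratian_at_2 => h.
    by apply: le_trans h _; rewrite -mulrA ler_wpM2l.
  have [_ hd] := dirichlet_term_bounds n ht.
  have hg : `|ka - G m t n| <= K3 * Y ^+ 2 * u.
    have -> : ka - G m t n = ka * (1 - dirichlet_term t n) by rewrite /G; ring.
    have -> : K3 * Y ^+ 2 * u = `|ka| * (2 * (n.+1%:R ^+ 2 * (Y ^+ 2 * u))) by rewrite /K3; ring.
    rewrite normrM ler_wpM2l//; apply: le_trans hd _.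
    have : n.+1%:R ^+ 2 * t ^+ 2 <= n.+1%:R ^+ 2 * (Y ^+ 2 * u) by rewrite ler_wpM2l// sqr_ge0.
    lra.
  have hf : `|F m t n.+1| <= K2 * u.
    rewrite /F /K2 normrM -mulrA ler_wpM2l// normrM normfV normr_nat.
    by rewrite ler_pM2r//; exact: dirichlet_sum_bound.
  have hxu : `|(q n.+1).[2 * cos t] / psi n.+1 / m%:R| <= K1 * u.
    by rewrite normrM normfV normr_nat ler_pM2r.
  have hyg : `|(V n).[2 * cos t] - G m t n| <= M2 * Y ^+ 2 * u + K3 * Y ^+ 2 * u.
    by rewrite -(subrKA ka); apply: le_trans (ler_normD _ _) _; exact: lerD.
  have hy' : `|(V n).[2 * cos t]| <= `|ka| + M2 * Y ^+ 2 * u.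
    by rewrite -[X in `|X|](subrK ka) addrC; apply: le_trans (ler_normD _ _) _; rewrite lerD2l.
  split.
    apply: le_trans (lerD (le_trans (ler_normB _ _) (lerD hxu hf)) hyg) _.
    by rewrite -/u; lra.
  apply: le_trans (lerD hxu hy') _; rewrite -/u.
  have : 0 <= K2 * u by rewrite mulr_ge0// ltW.
  have : 0 <= K3 * Y ^+ 2 * u by rewrite !mulr_ge0 ?sqr_ge0// ltW.
  lra.
have [m0 h] := @scaling_comparison R a b psi a_gt0 a_cvg1 psiE psi_cvg1 (fun m => m%:R)
   F G Y `|ka| N0 Y0 (normr_ge0 _) hFG hinit eta eta0.
exists m0 => m t mm t0 mt; have := h m t mm t0 mt.
by rewrite [m.+1%:R * _]mulrC mulfK ?pnatr_eq0.
Qed.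

End ScalingLimits.

(** * Signs of the scaling limits and location of the zeros *)

Lemma sin_ge_sin_margin {R : realType} (x de : R) : 0 <= de <= pi / 2 -> de <= x <= pi - de ->
  sin de <= sin x.
Proof.
move=> /andP[d0 d2] /andP[dx xd]; rewrite -!cosBpihalf -(cos_norm (x - _)) -(cos_norm (de - _)).
have p0 := @pi_gt0 R.
have e : `|de - pi / 2| = pi / 2 - de by rewrite distrC ger0_norm; lra.
have h : `|x - pi / 2| <= pi / 2 - de by rewrite ler_norml; apply/andP; split; lra.
have h0 := normr_ge0 (x - pi / 2).
by rewrite e ler_cos ?in_itv//=; apply/andP; split; lra.
Qed.

Lemma sin_sign_between {R : realType} (z de : R) i : 0 < de <= pi / 2 ->
  i%:R * pi + de <= z <= i.+1%:R * pi - de -> sin de <= (-1) ^+ i * sin z.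
Proof.
move=> /andP[d0 d2] /andP[z1 z2].
have -> : (-1) ^+ i * sin z = sin (z - i%:R * pi).
  have -> : sin z = sin ((z - i%:R * pi) + i%:R * pi) by congr sin; ring.
  by rewrite sin_shift_npi mulrA -expr2 sqrr_sign mul1r.
apply: sin_ge_sin_margin; first by rewrite d2 ltW.
by move: z2; rewrite -natr1 mulrDl mul1r => z2; apply/andP; split; lra.
Qed.

Lemma cos_sign_near {R : realType} (x : R) i : `|x - i%:R * pi| <= 1 ->
  2^-1 <= (-1) ^+ i * cos x.
Proof.
move=> h; have -> : (-1) ^+ i * cos x = cos (x - i%:R * pi).
  have -> : cos x = cos ((x - i%:R * pi) + i%:R * pi) by congr cos; ring.
  by rewrite cos_shift_npi mulrA -expr2 sqrr_sign mul1r.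
exact: cos_ge_half.
Qed.

(** An approximation of ka f with error below |ka| |f| has the sign of ka f. *)
Lemma sign_robust {R : realType} (ka sg v f eta : R) : ka != 0 -> `|sg| = 1 ->
  `|v - ka * f| <= `|ka| * eta -> eta < sg * f -> 0 < ka * sg * v.
Proof.
move=> ka0 sg1 h hf; have k0 : 0 < `|ka| by rewrite normr_gt0.
have -> : ka * sg * v = ka * ka * (sg * f) + (ka * sg) * (v - ka * f) by ring.
have h1 : `|ka * sg * (v - ka * f)| <= `|ka| * (`|ka| * eta).
  by rewrite !normrM sg1 mulr1 ler_pM2l.
have e : ka * ka = `|ka| * `|ka| by rewrite -normrM ger0_norm// -expr2 sqr_ge0.
have h2 : `|ka| * (`|ka| * eta) < `|ka| * (`|ka| * (sg * f)) by rewrite !ltr_pM2l.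
by move: h1; rewrite ler_norml e => /andP[h1 _]; lra.
Qed.

Section ZeroAsymptotics.
Context {R : realType}.
Variables (a b psi : nat -> R).
Hypotheses (a_gt0 : forall n, 0 < a n) (a0 : a 0%N = 1) (a_cvg1 : a @ \oo --> (1 : R))
  (psiE : forall n, a n.+1 * psi n.+2 + (b n.+1 - 2) * psi n.+1 + a n * psi n = 0)
  (psi_cvg1 : psi @ \oo --> (1 : R)).

Local Notation q := (shifted_poly a b).
Local Notation V := (casoratian a b psi).

(** The sign conditions of the counting argument, in terms of the angle t and
    for windows of half-width de. *)
Lemma zero_angle_window (om ka de : R) (j m : nat) :
  (0 < j)%N -> (0 < m)%N -> 0 < psi m.+1 -> 0 <= om <= pi / 2 -> 0 < de <= 4^-1 ->
  j%:R * pi + 1 <= m.+1%:R :> R ->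
  (forall i (t : R), (i <= j)%N -> 0 <= t -> m.+1%:R * t <= j%:R * pi + 1 ->
     (i == 0%N) || (i%:R * pi + de <= m.+1%:R * t + om) ->
     m.+1%:R * t + om <= i.+1%:R * pi - de ->
     0 < ka * (-1) ^+ i * ((q m.+1).[2 * cos t] / psi m.+1)) ->
  (forall i (t : R), (0 < i <= j)%N -> 0 <= t -> m.+1%:R * t <= j%:R * pi + 1 ->
     i%:R * pi - de <= m.+1%:R * t + om <= i%:R * pi + de ->
     0 < ka * (-1) ^+ i * (V m).[2 * cos t]) ->
  (j <= size (zeros_below_2 a b m))%N /\
  `|om + m.+1%:R * zero_angle a b m j - j%:R * pi| <= de.
Proof.
move=> j0 m0 psi0 /andP[om0 om2] /andP[d0 d4] mY gap window.
have p2 := @pi_ge2 R.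
have mp : (0 : R) < m.+1%:R by rewrite ltr0n.
have jp : 0 <= j%:R * pi :> R by rewrite mulr_ge0// pi_ge0.
have mt z : m.+1%:R * ((z - om) / m.+1%:R) = z - om by field; rewrite gt_eqF.
have small : (j%:R * pi + de - om) / m.+1%:R <= pi.
  rewrite ler_pdivrMr//; apply: (@le_trans _ _ m.+1%:R); first lra.
  by rewrite ler_peMl// ?ltW//; lra.
apply: (@nth_zero_angle R (q m.+1) (V m) ka om de m.+1 j) => //; try lra.
- move=> i z ij /andP[omz zj] hi hz.
  have := @gap i ((z - om) / m.+1%:R) ij; rewrite mt subrK.
  have t0 : 0 <= (z - om) / m.+1%:R by rewrite divr_ge0// subr_ge0.
  have zY : z - om <= j%:R * pi + 1 by lra.
  move=> /(_ t0 zY hi hz); rewrite mulrA pmulr_lgt0// invr_gt0//.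
- move=> i z ij hz; have /andP[i0 ij'] := ij.
  have ip : pi <= i%:R * pi :> R by rewrite ler_peMl ?pi_ge0// ler1n.
  have ijp : i%:R * pi <= j%:R * pi :> R by rewrite ler_wpM2r ?pi_ge0// ler_nat.
  have /andP[hz1 hz2] := hz.
  have := @window i ((z - om) / m.+1%:R) ij; rewrite mt subrK; apply => //.
    by rewrite divr_ge0// subr_ge0; lra.
  lra.
- move=> x; case: m m0 psi0 {mY gap window mp mt small} => // m _ psi0.
  by apply: wronskian_casoratian; rewrite ?gt_eqF.
Qed.

Lemma resonant_zero_window (de : R) (j : nat) : (0 < j)%N -> 0 < de <= 4^-1 ->
  psi 0%N = 0 -> exists m0, forall m, (m0 <= m)%N ->
  (j <= size (zeros_below_2 a b m))%N /\
  `|pi / 2 + m.+1%:R * zero_angle a b m j - j%:R * pi| <= de.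
Proof.
move=> j0 hde p0; have /andP[d0 d4] := hde; have p2 := @pi_ge2 R.
have [ka ka0 hka] := resonant_scaling a_gt0 a0 a_cvg1 psiE psi_cvg1 p0.
set Y : R := j%:R * pi + 1.
have Y0 : 0 < Y by rewrite /Y; have := mulr_ge0 (ler0n R j) (pi_ge0 R); lra.
have sd0 : 0 < sin de by apply: sin_gt0_pi; apply/andP; split; lra.
have sd1 := sin_le1 de.
have nk : 0 < `|ka| by rewrite normr_gt0.
(* The limits are at least sin de on the gaps and 3 / 16 on the windows, in units
   of ka; an error of sin de / 8 preserves both signs. *)
have eta0 : 0 < `|ka| * (sin de / 8) by rewrite mulr_gt0// divr_gt0.
have [m1 hm1] := hka Y _ Y0 eta0.
have [m2 hm2] := @nat_ge_eventually R Y.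
have [N hN] := coefficients_near1 a_cvg1 psi_cvg1 (@ltr01 R).
exists (maxn 1 (maxn m1 (maxn m2 N))) => m.
rewrite !geq_max => /andP[mgt0 /andP[m1m /andP[/leqW m2m /leqW Nm]]].
have Ym := hm2 _ m2m; have [psi0 _ _] := hN _ Nm.
have mp : (0 : R) < m.+1%:R by rewrite ltr0n.
apply: (@zero_angle_window _ ka) => //; first by apply/andP; split; lra.
- move=> i t ij t0 mt hi hz.
  have h := hm1 m t m1m t0 mt.
  apply: (@sign_robust _ ka _ _ (cos (m.+1%:R * t)) (sin de / 8)) => //.
  + by rewrite normr_sign.
  + by apply: le_trans h; rewrite lerDl.
  + have -> : cos (m.+1%:R * t) = sin (m.+1%:R * t + pi / 2) by rewrite sinDpihalf.
    have : sin de <= (-1) ^+ i * sin (m.+1%:R * t + pi / 2).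
      apply: sin_sign_between; first by apply/andP; split; lra.
      rewrite hz andbT; case/orP: hi => [/eqP ->|//].
      by rewrite mul0r add0r; have := mulr_ge0 (ltW mp) t0; lra.
    lra.
- move=> i t /andP[i0 ij] t0 mt /andP[z1 z2].
  have h := hm1 m t m1m t0 mt.
  have ip : pi <= i%:R * pi :> R by rewrite ler_peMl ?pi_ge0// ler1n.
  have t1 : t <= 1.
    by rewrite -(ler_pM2l mp) mulr1; apply: le_trans mt Ym.
  suff : 0 < ka * (-1) ^+ i * (m.+1%:R * (V m).[2 * cos t]).
    by rewrite [m.+1%:R * _]mulrC mulrA pmulr_lgt0.
  apply: (@sign_robust _ ka _ _ (m.+1%:R * (cos (m.+1%:R * t) - cos (m%:R * t))) (sin de / 8)) => //.
  + by rewrite normr_sign.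
  + by apply: le_trans h; rewrite [ka * (_ * _)]mulrCA lerDr.
  (* The difference of cosines is - 2 sin A sin (t / 2). *)
  set A := m.+1%:R * t - t / 2.
  have -> : cos (m.+1%:R * t) = cos (A + t / 2) by congr cos; rewrite /A; ring.
  have -> : cos (m%:R * t) = cos (A - t / 2).
    by congr cos; rewrite /A -natr1; field.
  rewrite (cosD A (t / 2)) (cosB A (t / 2)).
  have hA : 2^-1 <= (-1) ^+ i * - sin A.
    have -> : - sin A = cos (A + pi / 2) by rewrite cosDpihalf.
    apply: cos_sign_near; rewrite ler_norml /A; apply/andP; split; lra.
  have hs : t / 4 <= sin (t / 2).
    have := @sin_ge_half R (t / 2); have -> : t / 2 / 2 = t / 4 by field.
    by apply; apply/andP; split; lra.
  have mt4 : 3 / 4 <= m.+1%:R * t by lra.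
  have hms : 3 / 16 <= m.+1%:R * sin (t / 2).
    by apply: (@le_trans _ _ (m.+1%:R * (t / 4))); [lra|rewrite ler_pM2l].
  have -> : (-1) ^+ i * (m.+1%:R * (cos A * cos (t / 2) - sin A * sin (t / 2) -
     (cos A * cos (t / 2) + sin A * sin (t / 2)))) =
     2 * ((m.+1%:R * sin (t / 2)) * ((-1) ^+ i * - sin A)) by ring.
  have : 3 / 16 * 2^-1 <= (m.+1%:R * sin (t / 2)) * ((-1) ^+ i * - sin A).
    by apply: ler_pM => //; lra.
  lra.
Qed.

(** Close to the edge sin (k t) / sin t is bounded below by summands that are all
    at least 1/2; this excludes zeros near t = 0, where dividing by sin t is of
    no use. *)
Lemma dirichlet_sum_ge (t : R) k : 0 <= t -> k%:R * t <= 1 -> k%:R / 2 <= dirichlet_sum t k.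
Proof.
move=> t0 kt; have : forall l, (l <= k)%N -> l%:R / 2 <= dirichlet_sum t l; last exact.
elim=> [|l IH] lk; first by rewrite /dirichlet_sum big_geq// mul0r.
have lt1 : l.+1%:R * t <= 1 by apply: le_trans kt; rewrite ler_wpM2r// ler_nat.
rewrite -natr1 mulrDl mul1r in lt1.
have l0 : 0 <= l%:R * t by rewrite mulr_ge0.
have c1 : 2^-1 <= cos (l%:R * t + t / 2) by apply: cos_ge_half; rewrite ger0_norm; lra.
have c2 : 2^-1 <= cos (t / 2) by apply: cos_ge_half; rewrite ger0_norm; lra.
have : 2^-1 <= dirichlet_term t l.
  rewrite /dirichlet_term ler_pdivlMr; last by apply: lt_le_trans c2.
  by have := cos_le1 (t / 2); lra.
by have := IH (ltnW lk); rewrite dirichlet_sumS -natr1; lra.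
Qed.

Lemma nonresonant_zero_window (de : R) (j : nat) : (0 < j)%N -> 0 < de <= 4^-1 ->
  psi 0%N != 0 -> exists m0, forall m, (m0 <= m)%N ->
  (j <= size (zeros_below_2 a b m))%N /\
  `|0 + m.+1%:R * zero_angle a b m j - j%:R * pi| <= de.
Proof.
move=> j0 hde ka0; have /andP[d0 d4] := hde; have p2 := @pi_ge2 R.
set ka := psi 0%N in ka0.
set Y : R := j%:R * pi + 1.
have Y0 : 1 <= Y by rewrite /Y; have := mulr_ge0 (ler0n R j) (pi_ge0 R); lra.
have sd0 : 0 < sin de by apply: sin_gt0_pi; apply/andP; split; lra.
have sd1 := sin_le1 de.
have nk : 0 < `|ka| by rewrite normr_gt0.
(* Smaller than sin de / Y, a lower bound for |sin (m t) / (m sin t)| on the gaps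
   away from t = 0, and than 1 / 2, a lower bound near t = 0 and on the windows. *)
pose e1 := sin de / (2 * Y + 1).
have e10 : 0 < e1 by rewrite divr_gt0//; lra.
have e12 : e1 < 2^-1.
  by rewrite ltr_pdivrMr; lra.
have e1Y : e1 * Y < sin de.
  rewrite /e1 mulrAC ltr_pdivrMr; last lra.
  by rewrite ltr_pM2l//; lra.
have eta0 : 0 < `|ka| * e1 by rewrite mulr_gt0.
have Ygt0 : 0 < Y by lra.
have [m1 hm1] := nonresonant_scaling a_gt0 a0 a_cvg1 psiE psi_cvg1 Ygt0 eta0.
have [m2 hm2] := @nat_ge_eventually R Y.
have [N hN] := coefficients_near1 a_cvg1 psi_cvg1 (@ltr01 R).
exists (maxn 1 (maxn m1 (maxn m2 N))) => m.
rewrite !geq_max => /andP[mgt0 /andP[m1m /andP[/leqW m2m /leqW Nm]]].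
have Ym := hm2 _ m2m; have [psi0 _ _] := hN _ Nm.
have mp : (0 : R) < m.+1%:R by rewrite ltr0n.
apply: (@zero_angle_window _ ka) => //; first by apply/andP; split; lra.
- move=> i t ij t0 mt hi; rewrite addr0 in hi *; move=> hz.
  have h := hm1 m t m1m t0 mt.
  have t1 : t <= 1 by rewrite -(ler_pM2l mp) mulr1; apply: le_trans mt Ym.
  suff : 0 < ka * (-1) ^+ i * ((q m.+1).[2 * cos t] / psi m.+1 / m.+1%:R).
    by rewrite mulrA pmulr_lgt0// invr_gt0.
  apply: (@sign_robust _ ka _ _ (dirichlet_sum t m.+1 / m.+1%:R) e1) => //.
  + by rewrite normr_sign.
  + by apply: le_trans h; rewrite lerDl.
  have [small|large] := leP (m.+1%:R * t) de.
    have -> : i = 0%N.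
      case: i {ij hz} hi => // i /= hi; exfalso.
      by have := mulr_gt0 (ltr0Sn R i) (@pi_gt0 R); lra.
    rewrite mul1r; apply: lt_le_trans e12 _; rewrite ler_pdivlMr// mulrC.
    by apply: dirichlet_sum_ge => //; lra.
  have c2 : 2^-1 <= cos (t / 2) by apply: cos_ge_half; rewrite ger0_norm; lra.
  have c0 : cos (t / 2) != 0 by rewrite gt_eqF//; apply: lt_le_trans c2.
  have hs := sin_dirichlet_sum m.+1 c0.
  have tp : 0 < t by rewrite lt_neqAle t0 andbT; apply: contraTneq large => <-; rewrite mulr0 -leNgt ltW.
  have st0 : 0 < sin t by apply: sin_gt0_pi; apply/andP; split; lra.
  have stt : sin t <= t by have := sin_le_norm t0; rewrite ler_norml => /andP[].
  have hsin : sin de <= (-1) ^+ i * sin (m.+1%:R * t).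
    apply: sin_sign_between; first by apply/andP; split; lra.
    rewrite hz andbT; case/orP: hi => [/eqP ->|//].
    by rewrite mul0r add0r ltW.
  have -> : (-1) ^+ i * (dirichlet_sum t m.+1 / m.+1%:R) = ((-1) ^+ i * sin (m.+1%:R * t)) / (m.+1%:R * sin t).
    by rewrite -hs; field; rewrite !gt_eqF.
  rewrite ltr_pdivlMr ?mulr_gt0//; apply: lt_le_trans hsin.
  apply: le_lt_trans e1Y; rewrite ler_pM2l//; apply: le_trans mt.
  by rewrite ler_pM2l.
- move=> i t /andP[i0 ij] t0 mt; rewrite addr0 => /andP[z1 z2].
  have h := hm1 m t m1m t0 mt.
  have t1 : t <= 1 by rewrite -(ler_pM2l mp) mulr1; apply: le_trans mt Ym.
  apply: (@sign_robust _ ka _ _ (dirichlet_term t m) e1) => //.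
  + by rewrite normr_sign.
  + by apply: le_trans h; rewrite lerDr.
  apply: lt_le_trans e12 _; rewrite /dirichlet_term mulrA.
  have c2 : 2^-1 <= cos (t / 2) by apply: cos_ge_half; rewrite ger0_norm; lra.
  rewrite ler_pdivlMr; last by apply: lt_le_trans c2.
  have : 2^-1 <= (-1) ^+ i * cos (m%:R * t + t / 2).
    apply: cos_sign_near; rewrite -[m.+1%:R]natr1 in z1 z2.
    by rewrite ler_norml; apply/andP; split; lra.
  by have := cos_le1 (t / 2); lra.
Qed.

End ZeroAsymptotics.

(** The polynomial of degree n is q_(n+1), so the windows locate (n+1) theta;
    replacing n+1 by n costs theta itself, which is O(1/n). *)
Lemma angle_limit {R : realType} (a b : nat -> R) (om : R) (j : nat) : 0 <= om <= j%:R * pi ->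
  (forall de : R, 0 < de <= 4^-1 -> exists m0, forall m, (m0 <= m)%N ->
    (j <= size (zeros_below_2 a b m))%N /\
    `|om + m.+1%:R * zero_angle a b m j - j%:R * pi| <= de) ->
  (\forall n \near \oo, (j <= size (zeros_below_2 a b n))%N) /\
  (n%:R * zero_angle a b n j) @[n --> \oo] --> j%:R * pi - om.
Proof.
move=> /andP[om0 omj] h; have q0 : 0 < (4^-1 : R) <= 4^-1 by apply/andP; split; lra.
split.
  have [m0 hm] := h _ q0.
  by exists m0 => // m /hm[].
apply/cvgrPdist_le => e e0.
pose de := Num.min (e / 2) 4^-1.
have hde : 0 < de <= 4^-1.
  by rewrite lt_min ge_min lexx orbT andbT divr_gt0//=; lra.
have de2 : de <= e / 2 by rewrite /de ge_min lexx.
have [m0 hm] := h _ hde.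
have [m1 hm1] := @nat_ge_eventually R ((j%:R * pi + 1) / (e / 2)).
exists (maxn m0 m1) => // n; rewrite /= geq_max => /andP[/hm[_ hn] /leqW/hm1].
rewrite ler_pdivrMr ?divr_gt0// => hn1.
set th := zero_angle a b n j in hn *.
have mp : (0 : R) < n.+1%:R by rewrite ltr0n.
have d1 : de <= 4^-1 by case/andP: hde.
have jp : 0 <= j%:R * pi :> R by rewrite mulr_ge0// pi_ge0.
have hth : `|th| <= e / 2.
  rewrite -(ler_pM2l mp); apply: le_trans hn1.
  rewrite -[X in X * `|_|]ger0_norm// -normrM.
  by move: hn; rewrite !ler_norml => /andP[? ?]; apply/andP; split; lra.
have -> : j%:R * pi - om - n%:R * th = th - (om + n.+1%:R * th - j%:R * pi) by rewrite -natr1; ring.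
apply: le_trans (ler_normB _ _) _; lra.
Qed.

Theorem theorem3p8 (R : realType) (a b : nat -> R)
    (hab : jacobi_parameters a b)
    (hsum : cvgn (series (fun n : nat => n%:R * (`|a n - 1| + `|b n|))))
    (j : nat) (hj : (1 <= j)%N) :
  (\forall n \near \oo, (j <= size (zeros_below_2 a b n))%N) /\
  (resonance_at_2 a b ->
     (n%:R * zero_angle a b n j) @[n --> \oo] --> (j%:R - 2^-1) * pi) /\
  (~ resonance_at_2 a b ->
     (n%:R * zero_angle a b n j) @[n --> \oo] --> j%:R * pi).
Proof.
have a_gt0 := jacobi_a_gt0 hab; have a_cvg1 := jacobi_a_cvg1 hab hsum.
have [a0 _ _] := hab.
have [psi [psiE psi_cvg1 resE]] := jost_solution_at_2 hab hsum.
have p0 := @pi_ge0 R.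
have jp : pi <= j%:R * pi :> R by rewrite ler_peMl// ler1n.
have [/eqP psi0|psi0] := boolP (psi 0%N == 0).
  have om : 0 <= (pi : R) / 2 <= j%:R * pi by apply/andP; split; lra.
  have [hsize hlim] := angle_limit om (fun de hde =>
    resonant_zero_window a_gt0 a0 a_cvg1 psiE psi_cvg1 hj hde psi0).
  split; first exact: hsize.
  split=> [_|nres]; last by exfalso; apply/nres/resE.
  by rewrite mulrBl [2^-1 * pi]mulrC.
have om : 0 <= (0 : R) <= j%:R * pi by apply/andP; split; lra.
have [hsize hlim] := angle_limit om (fun de hde =>
  nonresonant_zero_window a_gt0 a0 a_cvg1 psiE psi_cvg1 hj hde psi0).
split; first exact: hsize.
split=> [res|_]; first by move: psi0; rewrite (resE.1 res) eqxx.
by rewrite subr0 in hlim.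
Qed.
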